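(* Let $\xi\in\mathbb{C}$ with $\mathrm{Re}(\xi)>0$ and define $g'_{\xi}\in A$ by $g'_{\xi}(a)=\exp\big(-\pi\xi\sum_{k\in L}a(k)^2\big)$. Then for every $b\in X$, $$(Fg'_{\xi})(b)=B_{\xi}(b)\,g'_{\xi}\!\left(\tfrac{b}{\xi}\right)=B_{\xi}(b)\exp\Big(-\tfrac{\pi}{\xi}\sum_{k\in L}b(k)^2\Big),\qquad B_{\xi}(b)=\sum_{a\in X}\varepsilon_0\exp\Big(-\pi\xi\sum_{k\in L}\big(a(k)+i\tfrac1\xi b(k)\big)^2\Big).$$ Furthermore, if there exists $b_0\in{}^*\mathbb{R}$ with $|b(k)|\le\star(b_0)$ for all $k\in L$, then $$\mathrm{st}(B_{\xi}(b))=\Big({}^{*}\Big(\tfrac{1}{\sqrt{\xi}}\Big)\Big)^{H^2}\in{}^{*}\mathbb{C}\quad\text{and}\quad\mathbf{st}\left(\frac{B_{\xi}(b)}{\star\Big(\big({}^{*}(\tfrac{1}{\sqrt{\xi}})\big)^{H^2}\Big)}\right)=1,$$ with $\sqrt\xi$ the principal square root.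
   Context: Double nonstandard framework: ${}^{*}S=S^{\Lambda_2}/F_2$ for a nonprincipal ultrafilter $F_2$ on an infinite set $\Lambda_2$; for a ${}^*$-internal set $S$, ${}^{\star}S$ is its ${}^*$-ultrapower with respect to ${}^*F_1$, $F_1$ a nonprincipal ultrafilter on an infinite set $\Lambda_1$; ${}^\star x$ or $\star(x)$ is the image of $x$; ''internal'' means internal with a double meaning. $\mathrm{st}$ is the standard part map from elements of ${}^{\star}({}^{*}\mathbb{C})$ bounded by an element of ${}^*\mathbb{R}$ to ${}^*\mathbb{C}$, and $\mathbf{st}=\mathrm{st}\circ\mathrm{st}$ is the standard part with respect to the embedding $\star\circ *:\mathbb{R}\to{}^{\star}({}^*\mathbb{R})$. Let $H\in{}^{*}\mathbb{Z}$ be a positive even infinite number and $H'\in{}^{\star}({}^{*}\mathbb{Z})$ a positive even number larger than every element of ${}^{*}\mathbb{Z}$; $\varepsilon=1/H$, $\varepsilon'=1/H'$. $L=\{\varepsilon z: z\in{}^*\mathbb{Z},\,-H/2\le\varepsilon z<H/2\}$ (size $H^2$), and (this setting) $L'=\{\varepsilon' z': z'\in{}^{\star}({}^{*}\mathbb{Z}),\,-\frac{H'}{2}\le \varepsilon' z'<\frac{H'}{2}\}$, identified with $\varepsilon'\,{}^{\star}({}^*\mathbb{Z})$ modulo $H'$. $X$ is the set of internal functions ${}^{\star}L\to L'$, $A$ the set of internal functions $X\to{}^{\star}({}^{*}\mathbb{C})$, $\varepsilon_0=H'^{-({}^{\star}H)^2}$, and $(Ff)(b)=\sum_{a\in X}\varepsilon_0\exp\big(-2\pi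 i\sum_{k\in L}a(k)b(k)\big)f(a)$. *)

(* Defs.v *)
From HB Require Import structures.
From mathcomp Require Import all_boot all_order all_algebra.
From mathcomp Require Import generic_quotient.
From mathcomp Require Import complex.
From mathcomp Require Import all_classical all_reals all_analysis.

Set Implicit Arguments.
Unset Strict Implicit.
Unset Printing Implicit Defensive.

Import Order.TTheory GRing.Theory Num.Theory.

Local Open Scope classical_set_scope.
Local Open Scope ring_scope.
Local Open Scope complex_scope.
Local Open Scope quotient_scope.

Record npUltraFilter (I : Type) := NpUltraFilter {
  npu_sets :> set I -> Prop;
  npu_ultra : UltraFilter npu_sets;
  npu_nonprincipal : forall i : I, npu_sets <> [set A | A i] }.

#[global] Existing Instance npu_ultra.

Section Ultrapower.
Context (I : Type) (F : npUltraFilter I).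

Definition ae_eq_rel (T : Type) (f g : {classic (I -> T)}) : bool :=
  `[< F [set i | f i = g i] >].

Lemma ae_eq_equiv (T : Type) : equiv_class_of (@ae_eq_rel T).
Proof.
split=> [f|f g|g f h] /=.
- by apply/asboolP; apply: filterS filterT.
- by apply/asboolP/asboolP; apply: filterS => i /= ->.
- move=> /asboolP fg /asboolP gh; apply/asboolP.
  by apply: filterS2 fg gh => i /= -> ->.
Qed.

Definition ae_eq (T : Type) : equiv_rel {classic (I -> T)} :=
  EquivRelPack (ae_eq_equiv T).

Definition upow (T : Type) : Type := {eq_quot @ae_eq T}.

HB.instance Definition _ (T : Type) := Choice.on (upow T).

Definition ucls (T : Type) (f : I -> T) : upow T := \pi_{eq_quot @ae_eq T} f.
Definition urepr (T : Type) (x : upow T) : I -> T :=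
  repr (x : {eq_quot @ae_eq T}).

Definition std (T : Type) (x : T) : upow T := ucls (fun=> x).

Definition umap (T U : Type) (f : T -> U) (x : upow T) : upow U :=
  ucls (fun i => f (urepr x i)).

Definition umap2 (T U V : Type) (f : T -> U -> V) (x : upow T) (y : upow U) :
  upow V := ucls (fun i => f (urepr x i) (urepr y i)).

Definition uapp (T U : Type) (phi : upow (T -> U)) (x : upow T) : upow U :=
  umap2 (fun g t => g t) phi x.

Definition upred (T : Type) (P : T -> Prop) (x : upow T) : Prop :=
  F [set i | P (urepr x i)].

Definition urel (T U : Type) (r : T -> U -> Prop) (x : upow T) (y : upow U) :
  Prop := F [set i | r (urepr x i) (urepr y i)].

Lemma uclsP (T : Type) (f g : I -> T) :
  ucls f = ucls g <-> F [set i | f i = g i].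
Proof.
split=> [/eqP|fg]; first by rewrite eqmodE => /asboolP.
by apply/eqP; rewrite eqmodE; apply/asboolP.
Qed.

Lemma ureprK (T : Type) (x : upow T) : ucls (urepr x) = x.
Proof. exact: reprK. Qed.

Lemma urepr_cls (T : Type) (f : I -> T) : F [set i | urepr (ucls f) i = f i].
Proof. by apply/uclsP; rewrite ureprK. Qed.

Lemma uclsW (T : Type) (P : upow T -> Prop) :
  (forall f, P (ucls f)) -> forall x, P x.
Proof. by move=> Pf x; rewrite -(ureprK x). Qed.

Lemma umap_cls (T U : Type) (f : T -> U) (x : I -> T) :
  umap f (ucls x) = ucls (fun i => f (x i)).
Proof.
by apply/uclsP; apply: filterS (urepr_cls x) => i /= ->.
Qed.

Lemma umap2_cls (T U V : Type) (f : T -> U -> V) (x : I -> T) (y : I -> U) :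
  umap2 f (ucls x) (ucls y) = ucls (fun i => f (x i) (y i)).
Proof.
apply/uclsP.
by apply: filterS2 (urepr_cls x) (urepr_cls y) => i /= -> ->.
Qed.

Lemma upred_cls (T : Type) (P : T -> Prop) (x : I -> T) :
  upred P (ucls x) <-> F [set i | P (x i)].
Proof.
by split; apply: filterS2 (urepr_cls x) => i /= ->.
Qed.

Lemma urel_cls (T U : Type) (r : T -> U -> Prop) (x : I -> T) (y : I -> U) :
  urel r (ucls x) (ucls y) <-> F [set i | r (x i) (y i)].
Proof.
have xy : F [set i | urepr (ucls x) i = x i /\ urepr (ucls y) i = y i].
  by apply: filterS2 (urepr_cls x) (urepr_cls y).
by split; apply: filterS2 xy => i /= [-> ->].
Qed.

Lemma npu_setVsetC (A : set I) : F A \/ F (~` A).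
Proof. exact: in_ultra_setVsetC. Qed.

Lemma npu_or (A B : set I) : F (A `|` B) -> F A \/ F B.
Proof.
move=> AB; have [?|nA] := npu_setVsetC A; first by left.
by right; apply: filterS2 AB nA => i [].
Qed.

Lemma npu_not (A : set I) : F (~` A) <-> ~ F A.
Proof.
split=> [nA FA|]; last by have [] := npu_setVsetC A.
have : F set0 by apply: filterS2 FA nA => i.
exact: filter_not_empty.
Qed.

End Ultrapower.

Arguments ucls {I} F {T} f.
Arguments std {I} F {T} x.
Arguments umap_cls {I F T U}.
Arguments umap2_cls {I F T U V}.
Arguments urel_cls {I F T U}.

Section Zmod.
Context (I : Type) (F : npUltraFilter I) (V : zmodType).
Local Notation uV := (upow F V).

Lemma uaddA : associative (umap2 +%R : uV -> uV -> uV).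
Proof.
move=> x y z; elim/uclsW: x => x; elim/uclsW: y => y; elim/uclsW: z => z.
rewrite (umap2_cls _ y z) (umap2_cls _ x y) !umap2_cls.
by congr (ucls _ _); apply/funext => i; rewrite addrA.
Qed.

Lemma uaddC : commutative (umap2 +%R : uV -> uV -> uV).
Proof.
move=> x y; elim/uclsW: x => x; elim/uclsW: y => y; rewrite !umap2_cls.
by congr (ucls _ _); apply/funext => i; rewrite addrC.
Qed.

Lemma uadd0 : left_id (std F 0) (umap2 +%R : uV -> uV -> uV).
Proof.
move=> x; elim/uclsW: x => x; rewrite umap2_cls.
by congr (ucls _ _); apply/funext => i; rewrite add0r.
Qed.

Lemma uaddN : left_inverse (std F 0) (umap -%R) (umap2 +%R : uV -> uV -> uV).
Proof.
move=> x; elim/uclsW: x => x; rewrite umap_cls umap2_cls.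
by congr (ucls _ _); apply/funext => i; rewrite addNr.
Qed.

HB.instance Definition _ :=
  GRing.isZmodule.Build (upow F V) uaddA uaddC uadd0 uaddN.

End Zmod.

Section ComRing.
Context (I : Type) (F : npUltraFilter I) (A : comNzRingType).
Local Notation uA := (upow F A).

Lemma umulA : associative (umap2 *%R : uA -> uA -> uA).
Proof.
move=> x y z; elim/uclsW: x => x; elim/uclsW: y => y; elim/uclsW: z => z.
rewrite (umap2_cls _ y z) (umap2_cls _ x y) !umap2_cls.
by congr (ucls _ _); apply/funext => i; rewrite mulrA.
Qed.

Lemma umulC : commutative (umap2 *%R : uA -> uA -> uA).
Proof.
move=> x y; elim/uclsW: x => x; elim/uclsW: y => y; rewrite !umap2_cls.
by congr (ucls _ _); apply/funext => i; rewrite mulrC.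
Qed.

Lemma umul1 : left_id (std F 1) (umap2 *%R : uA -> uA -> uA).
Proof.
move=> x; elim/uclsW: x => x; rewrite umap2_cls.
by congr (ucls _ _); apply/funext => i; rewrite mul1r.
Qed.

Lemma umulD : left_distributive (umap2 *%R : uA -> uA -> uA) +%R.
Proof.
move=> x y z; elim/uclsW: x => x; elim/uclsW: y => y; elim/uclsW: z => z.
rewrite /GRing.add/= (umap2_cls _ x y) (umap2_cls _ x z) (umap2_cls _ y z).
rewrite !umap2_cls.
by congr (ucls _ _); apply/funext => i; rewrite mulrDl.
Qed.

Lemma uone_neq0 : std F 1 != 0 :> uA.
Proof.
apply/eqP => /uclsP F01; apply: (@filter_not_empty _ F _).
by apply: filterS F01 => i /= /eqP; rewrite oner_eq0.
Qed.

HB.instance Definition _ := GRing.Zmodule_isComNzRing.Build (upow F A)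
  umulA umulC umul1 umulD uone_neq0.

End ComRing.

Section UnitRing.
Context (I : Type) (F : npUltraFilter I) (A : comUnitRingType).
Local Notation uA := (upow F A).

Definition uunit : pred uA :=
  fun x => `[< upred (fun t => t \is a GRing.unit) x >].

Lemma uunitVl : {in uunit, left_inverse 1 (umap GRing.inv) ( *%R : uA -> _)}.
Proof.
move=> x; elim/uclsW: x => x /asboolP/upred_cls ux.
rewrite /GRing.mul/= umap_cls umap2_cls; apply/uclsP.
by apply: filterS ux => i /= ?; rewrite mulVr.
Qed.

Lemma uunitPl (x y : uA) : y * x = 1 -> uunit x.
Proof.
elim/uclsW: x => x; elim/uclsW: y => y.
rewrite /GRing.mul/= umap2_cls => /uclsP yx; apply/asboolP/upred_cls.
by apply: filterS yx => i /= yx; apply/unitrPr; exists (y i); rewrite mulrC.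
Qed.

Lemma uinv_out : {in [predC uunit], umap GRing.inv =1 @id uA}.
Proof.
move=> x; elim/uclsW: x => x /asboolP nux; rewrite umap_cls; apply/uclsP.
have /npu_not : ~ F [set i | x i \is a GRing.unit].
  by move=> h; apply: nux; apply/upred_cls.
by apply: filterS => i /= /negP; exact: invr_out.
Qed.

HB.instance Definition _ := GRing.ComNzRing_hasMulInverse.Build (upow F A)
  uunitVl uunitPl uinv_out.

End UnitRing.

Section IDomain.
Context (I : Type) (F : npUltraFilter I) (A : idomainType).

Lemma umulf_eq0 (x y : upow F A) : x * y = 0 -> (x == 0) || (y == 0).
Proof.
elim/uclsW: x => x; elim/uclsW: y => y.
rewrite /GRing.mul/= umap2_cls => /uclsP xy.
have /npu_or[x0|y0] : F ([set i | x i = 0] `|` [set i | y i = 0]).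
  apply: filterS xy => i /= /eqP; rewrite mulf_eq0.
  by move=> /orP[]/eqP; [left|right].
- by apply/orP; left; apply/eqP/uclsP.
- by apply/orP; right; apply/eqP/uclsP.
Qed.

HB.instance Definition _ :=
  GRing.ComUnitRing_isIntegral.Build (upow F A) umulf_eq0.

End IDomain.

Section UField.
Context (I : Type) (F : npUltraFilter I) (K : fieldType).

Lemma ufield : GRing.field_axiom (upow F K).
Proof.
move=> x; elim/uclsW: x => x x0; apply/asboolP/upred_cls.
have /npu_not : ~ F [set i | x i = 0].
  by move=> h; move/eqP: x0; apply; apply/uclsP.
by apply: filterS => i /= /eqP; rewrite unitfE.
Qed.

HB.instance Definition _ := GRing.UnitRing_isField.Build (upow F K) ufield.

End UField.

Section UNum.
Context (I : Type) (F : npUltraFilter I) (K : numDomainType).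
Local Notation uK := (upow F K).

Definition ule (x y : uK) : bool := `[< urel (fun s t : K => s <= t) x y >].
Definition ult (x y : uK) : bool := `[< urel (fun s t : K => s < t) x y >].
Definition unorm : uK -> uK := umap Num.norm.

Lemma unormD (x y : uK) : ule (unorm (x + y)) (unorm x + unorm y).
Proof.
elim/uclsW: x => x; elim/uclsW: y => y; apply/asboolP.
rewrite /unorm /GRing.add/= ?(umap_cls, umap2_cls); apply/urel_cls.
by apply: filterS filterT => i _ /=; exact: ler_normD.
Qed.

Lemma uaddr_gt0 (x y : uK) : ult 0 x -> ult 0 y -> ult 0 (x + y).
Proof.
elim/uclsW: x => x; elim/uclsW: y => y /asboolP/urel_cls x0 /asboolP/urel_cls y0.
apply/asboolP; rewrite /GRing.add/= umap2_cls; apply/urel_cls.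
by apply: filterS2 x0 y0 => i /=; exact: addr_gt0.
Qed.

Lemma unorm_eq0 (x : uK) : unorm x = 0 -> x = 0.
Proof.
elim/uclsW: x => x; rewrite /unorm umap_cls => /uclsP x0; apply/uclsP.
by apply: filterS x0 => i /= /eqP; rewrite normr_eq0 => /eqP.
Qed.

Lemma uger_total (x y : uK) : ule 0 x -> ule 0 y -> ule x y || ule y x.
Proof.
elim/uclsW: x => x; elim/uclsW: y => y /asboolP/urel_cls x0 /asboolP/urel_cls y0.
have /npu_or[xy|yx] : F ([set i | x i <= y i] `|` [set i | y i <= x i]).
  apply: filterS2 x0 y0 => i /= x0 y0.
  by have /orP := ger_leVge x0 y0.
- by apply/orP; left; apply/asboolP/urel_cls.
- by apply/orP; right; apply/asboolP/urel_cls.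
Qed.

Lemma unormM : {morph unorm : x y / x * y}.
Proof.
move=> x y; elim/uclsW: x => x; elim/uclsW: y => y.
rewrite /unorm /GRing.mul/= ?(umap_cls, umap2_cls).
by congr (ucls _ _); apply/funext => i; rewrite normrM.
Qed.

Lemma ule_def (x y : uK) : ule x y = (unorm (y - x) == y - x).
Proof.
elim/uclsW: x => x; elim/uclsW: y => y.
rewrite /unorm /GRing.add/GRing.opp/= ?(umap_cls, umap2_cls).
apply/asboolP/eqP => [/urel_cls|/uclsP] xy; [apply/uclsP|apply/urel_cls];
  apply: filterS xy => i /=.
- by rewrite -subr_ge0 => ?; rewrite ger0_norm.
- by move=> /eqP; rewrite -subr_ge0 ger0_def.
Qed.

Lemma ult_def (x y : uK) : ult x y = (y != x) && ule x y.
Proof.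
elim/uclsW: x => x; elim/uclsW: y => y.
apply/asboolP/andP => [/urel_cls xy|[/eqP yx /asboolP/urel_cls xy]].
- split; last by apply/asboolP/urel_cls; apply: filterS xy => i /= /ltW.
  apply/eqP => /uclsP yx; apply: (@filter_not_empty _ F _).
  by apply: filterS2 xy yx => i /= + yx; rewrite yx ltxx.
- have /npu_not nyx : ~ F [set i | y i = x i] by move=> h; apply/yx/uclsP.
  apply/urel_cls; apply: filterS2 xy nyx => i /= xyi /eqP yxi.
  by rewrite lt_def yxi.
Qed.

HB.instance Definition _ := Num.IntegralDomain_isNumRing.Build (upow F K)
  unormD uaddr_gt0 unorm_eq0 uger_total unormM ule_def ult_def.

End UNum.


(* Write * for the F2-extension and # for the second one. The ultrapower      *)
(* formed inside the *-universe with respect to *F1 of the *-internal set     *)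
(* given by a family (S_i)_(i in I2) is, unfolding what * means, the          *)
(* F2-ultraproduct of the F1-ultrapowers of the S_i; for S = *T this is       *)
(* #*T = dpow F1 F2 T.                                                        *)
Notation dpow F1 F2 T := (upow F2 (upow F1 T)).

Section Double.
Context (I1 I2 : Type) (F1 : npUltraFilter I1) (F2 : npUltraFilter I2).

Local Notation dpow T := (dpow F1 F2 T).

Definition starmap (T : Type) (x : upow F2 T) : dpow T := umap (std F1) x.

Definition dstd (T : Type) (x : T) : dpow T := starmap (std F2 x).

Definition dmap (T U : Type) (f : T -> U) : dpow T -> dpow U := umap (umap f).

Definition dmap2 (T U V : Type) (f : T -> U -> V) :
  dpow T -> dpow U -> dpow V := umap2 (umap2 f).

(* Elements of dpow (T -> U) are the internal functions from #*T to #*U, and  *)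
(* dapp is their evaluation.                                                  *)
Definition dapp (T U : Type) (phi : dpow (T -> U)) (x : dpow T) : dpow U :=
  umap2 (@uapp _ F1 T U) phi x.

(* The actual subsets of *T and of #*T given by internal sets.                *)
Definition uext (I : Type) (F : npUltraFilter I) (T : Type)
  (A : upow F (set T)) : set (upow F T) := [set x | urel (fun B t => B t) A x].

Definition dext (T : Type) (A : dpow (set T)) : set (dpow T) :=
  [set x | urel (fun B t => uext B t) A x].

Definition star_set (T : Type) (S : set (upow F2 T)) : set (dpow T) :=
  [set x | exists A : upow F2 (set T), S = uext A /\ dext (starmap A) x].

Definition internal_on (T U : Type) (S : set (dpow T)) (f : dpow T -> dpow U) :
  Prop := exists phi : dpow (T -> U), forall x, S x -> f x = dapp phi x.

(* Sum of the internal function f over the internal hyperfinite set S: the    *)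
(* extension of the finite sum, evaluated at S and at any internal function   *)
(* agreeing with f on S; 0 when S is not hyperfinite or f is not internal.    *)
Definition isum (T : choiceType) (V : zmodType) (S : set (dpow T))
    (f : dpow T -> dpow V) : dpow V :=
  xget 0 [set s | exists (A : dpow (set T)) (phi : dpow (T -> V)),
    [/\ S = dext A,
        upred (upred (@finite_set T)) A,
        forall x, S x -> f x = dapp phi x &
        s = dmap2 (fun B g => \sum_(t \in B) g t) A phi]].

End Double.

Arguments starmap {I1 I2} F1 {F2 T} x.
Arguments dstd {I1 I2} F1 F2 {T} x.
Arguments star_set {I1 I2} F1 {F2 T} S _.

Lemma npu_forall (I : Type) (F : npUltraFilter I) (T : Type) (P Q : I -> set T) :
  (forall x : I -> T, F [set i | P i (x i)] -> F [set i | Q i (x i)]) ->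
  F [set i | P i `<=` Q i].
Proof.
move=> PQ; have [//|nPQ] := npu_setVsetC F [set i | P i `<=` Q i].
have ex i : (~` [set i | P i `<=` Q i]) i -> exists t, P i t /\ ~ Q i t.
  by move=> /existsNP[t /not_implyP[]]; exists t.
have [i0 /ex[t0 _]] := filter_ex nPQ.
have [i|x xP] := @boolp.choice _ _ (fun i t =>
    (~` [set i | P i `<=` Q i]) i -> P i t /\ ~ Q i t).
  have [/ex[t ?]|?] := pselect ((~` [set i | P i `<=` Q i]) i); last by exists t0.
  by exists t.
have Px : F [set i | P i (x i)] by apply: filterS nPQ => i /xP[].
have : F set0 by apply: filterS2 (PQ _ Px) nPQ => i Qx /xP[].
by move=> /(@filter_not_empty _ F _).
Qed.

Lemma uext_inj (I : Type) (F : npUltraFilter I) (T : Type) :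
  injective (@uext I F T).
Proof.
have sub (A B : I -> set T) : uext (ucls F A) `<=` uext (ucls F B) ->
    F [set i | A i `<=` B i].
  move=> AB; apply: npu_forall => x /(urel_cls (fun C t => C t)).
  by move=> /(AB (ucls F x))/urel_cls.
move=> A B; elim/uclsW: A => A; elim/uclsW: B => B AB; apply/uclsP.
have h1 : F [set i | A i `<=` B i] by apply: sub; rewrite AB.
have h2 : F [set i | B i `<=` A i] by apply: sub; rewrite AB.
by apply: filterS2 h1 h2 => i /= ? ?; apply/seteqP.
Qed.

Section SumWellDefined.
Context (I1 I2 : Type) (F1 : npUltraFilter I1) (F2 : npUltraFilter I2).

Lemma dext_inj (T : Type) : injective (@dext I1 I2 F1 F2 T).
Proof.
have sub (A B : I2 -> upow F1 (set T)) : dext (ucls F2 A) `<=` dext (ucls F2 B) ->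
    F2 [set i | uext (A i) `<=` uext (B i)].
  move=> AB; apply: npu_forall => x /(urel_cls (fun C t => uext C t)).
  by move=> /(AB (ucls F2 x))/urel_cls.
move=> A B; elim/uclsW: A => A; elim/uclsW: B => B AB; apply/uclsP.
have h1 : F2 [set i | uext (A i) `<=` uext (B i)] by apply: sub; rewrite AB.
have h2 : F2 [set i | uext (B i) `<=` uext (A i)] by apply: sub; rewrite AB.
by apply: filterS2 h1 h2 => i /= ? ?; apply/uext_inj/seteqP.
Qed.

Lemma isumE (T : choiceType) (V : zmodType) (A : dpow F1 F2 (set T))
    (f : dpow F1 F2 T -> dpow F1 F2 V) (phi : dpow F1 F2 (T -> V)) :
  upred (upred (@finite_set T)) A ->
  (forall x, dext A x -> f x = dapp phi x) ->
  isum (dext A) f = dmap2 (fun B g => \sum_(t \in B) g t) A phi.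
Proof.
move=> finA fphi; rewrite /isum; case: xgetP => [s _|/(_ _)]; last first.
  by move=> /(_ (dmap2 (fun B g => \sum_(t \in B) g t) A phi))[]; exists A, phi.
move=> [A' [psi [/dext_inj <- _ fpsi ->]]] {finA A' s}.
elim/uclsW: A fphi fpsi => A; elim/uclsW: phi => phi; elim/uclsW: psi => psi.
move=> fphi fpsi; rewrite /dmap2 !umap2_cls; apply/uclsP.
have : F2 [set i | uext (A i) `<=`
    [set x | uapp (psi i) x = uapp (phi i) x]].
  apply: npu_forall => x Ax; apply/uclsP.
  have Ax' : dext (ucls F2 A) (ucls F2 x) by apply/urel_cls.
  by rewrite -(umap2_cls (@uapp _ F1 T V)) -(umap2_cls (@uapp _ F1 T V))
    -[LHS]fpsi // -[RHS]fphi.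
apply: filterS => i /=.
elim/uclsW: (A i) => B; elim/uclsW: (psi i) => g; elim/uclsW: (phi i) => h.
move=> gh; rewrite !umap2_cls; apply/uclsP.
have : F1 [set j | B j `<=` [set t | g j t = h j t]].
  apply: npu_forall => x Bx; apply/uclsP.
  rewrite -(umap2_cls (fun g t => g t)) -(umap2_cls (fun g t => g t)).
  by apply: gh; apply/urel_cls.
by apply: filterS => j /= Bgh; apply: eq_fsbigr => t; rewrite inE; exact: Bgh.
Qed.

End SumWellDefined.

Section Transform.
Context (R : realType) (I1 I2 : Type).
Context (F1 : npUltraFilter I1) (F2 : npUltraFilter I2).
Local Notation starR := (upow F2 R).
Local Notation starC := (upow F2 R[i]).
Local Notation starZ := (upow F2 int).
Local Notation dR := (dpow F1 F2 R).
Local Notation dC := (dpow F1 F2 R[i]).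
Local Notation dZ := (dpow F1 F2 int).
Local Notation "c %:D" := (dstd F1 F2 c) (at level 2, format "c %:D").

Definition cexp (z : R[i]) : R[i] :=
  (expR (complex.Re z))%:C *
  (cos (complex.Im z) +i* sin (complex.Im z)).

Definition starC_of (x : starR) : starC := umap (real_complex R) x.
Definition dC_of (x : dR) : dC := dmap (real_complex R) x.
Definition dexp (x : dC) : dC := dmap cexp x.

Definition starC_expz (x : starC) (n : starZ) : starC :=
  umap2 (@exprz R[i]) x n.

(* Norms of elements of R[i] and of its extensions are themselves complex;    *)
(* x <= y there means that y - x is a nonnegative real.                       *)
Definition st_dom (x : dC) : Prop :=
  exists r : starR, `|x| <= starmap F1 (starC_of r).

Definition st (x : dC) : starC :=
  xget 0 [set y : starC | forall e : starR, 0 < e ->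
    `|x - starmap F1 y| < starmap F1 (starC_of e)].

Definition st0_dom (x : starC) : Prop :=
  exists r : R, `|x| <= std F2 r%:C.

Definition st0 (x : starC) : R[i] :=
  xget 0 [set y : R[i] | forall e : R, 0 < e ->
    `|x - std F2 y| < std F2 e%:C].

Definition bst_dom (x : dC) : Prop := st_dom x /\ st0_dom (st x).

Definition bst (x : dC) : R[i] := st0 (st x).

Context (H : starZ) (H' : dZ).

Definition HR : starR := umap intr H.
Definition HR' : dR := dmap intr H'.

Definition latL : set starR :=
  [set x | exists z : starZ, x = HR^-1 * umap intr z /\ - (HR / 2) <= x < HR / 2].

Definition latL' : set dR :=
  [set x | exists z : dZ, x = HR'^-1 * dmap intr z /\ - (HR' / 2) <= x < HR' / 2].

(* An internal function from #L to L' is represented by its extension by 0    *)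
(* outside #L, so that distinct elements of funX are distinct functions.      *)
Definition funX : set (dpow F1 F2 (R -> R)) :=
  [set a | (forall k : dR, star_set F1 latL k -> latL' (dapp a k)) /\
           (forall k : dR, ~ star_set F1 latL k -> dapp a k = 0)].

Definition funA : set (dpow F1 F2 (R -> R) -> dC) :=
  [set f | internal_on funX f].

Definition sumL (V : zmodType) (f : dR -> dpow F1 F2 V) : dpow F1 F2 V :=
  isum (star_set F1 latL) f.

Definition eps0 : dR := dmap2 (@exprz R) HR' (- (starmap F1 H) ^+ 2).

Definition FT (f : dpow F1 F2 (R -> R) -> dC) (b : dpow F1 F2 (R -> R)) : dC :=
  isum funX (fun a => dC_of eps0 *
    dexp (- (2 * (pi%:C)%:D * 'i%:D *
      dC_of (sumL (fun k => dapp a k * dapp b k)))) * f a).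

Definition gauss (xi : R[i]) (c : dR -> dC) : dC :=
  dexp (- ((pi%:C)%:D * xi%:D * sumL (fun k => c k ^+ 2))).

Definition gaussX (xi : R[i]) (a : dpow F1 F2 (R -> R)) : dC :=
  gauss xi (fun k => dC_of (dapp a k)).

Definition Bxi (xi : R[i]) (b : dpow F1 F2 (R -> R)) : dC :=
  isum funX (fun a => dC_of eps0 *
    dexp (- ((pi%:C)%:D * xi%:D *
      sumL (fun k => (dC_of (dapp a k) +
                      'i%:D * (xi%:D)^-1 * dC_of (dapp b k)) ^+ 2)))).

End Transform.

(* Main.v *)
From HB Require Import structures.
Require Import Defs.
From mathcomp Require Import all_boot all_order all_algebra.
From mathcomp Require Import finmap complex.
From mathcomp Require Import all_classical all_reals all_analysis.
From mathcomp Require Import ring lra zify.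
Import Order.TTheory GRing.Theory Num.Theory.
Import numFieldNormedType.Exports.
Import Normc.
Local Open Scope classical_set_scope.
Local Open Scope ring_scope.
Local Open Scope complex_scope.

Set Implicit Arguments.
Unset Strict Implicit.
Unset Printing Implicit Defensive.

(* The double ultrapower is an ultrapower over I2 * I1, in which the internal *)
(* sums are families of ordinary finite sums. Completing the square gives the *)
(* formula for F(g'_xi). The sum B_xi(b) factors over k in L into the H^2     *)
(* one-dimensional sums                                                       *)
(*   sum_x h exp (- pi xi (x + i b(k) / xi) ^ 2),  h = 1 / H'.                *)
(* With s = sqrt xi, it remains to show that s times such a sum tends to 1 as *)
(* H' grows, uniformly for bounded b. Deform (s, i b / s) linearly to (1, 0): *)
(* the derivative of sigma exp (- pi (sigma x + tau) ^ 2) along the           *)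
(* deformation is the x-derivative of                                         *)
(*   (sigma' x + tau') exp (- pi (sigma x + tau) ^ 2),                        *)
(* so its Riemann sum telescopes up to O(h). At (1, 0) the sum is a Riemann   *)
(* sum of a normal density. As H^2 is finite at each index in I2, the product *)
(* of the limits is the limit of B_xi(b).                                     *)

(** * Calculus of complex-valued functions of a real variable *)

Section ComplexParts.
Context {R : rcfType}.
Implicit Types z w : R[i].

Lemma Re_complexD z w : complex.Re (z + w) = complex.Re z + complex.Re w.
Proof. by case: z w => ? ? []. Qed.

Lemma Im_complexD z w : complex.Im (z + w) = complex.Im z + complex.Im w.
Proof. by case: z w => ? ? []. Qed.

Lemma Re_complexM z w : complex.Re (z * w) =
  complex.Re z * complex.Re w - complex.Im z * complex.Im w.
Proof. by case: z w => ? ? []. Qed.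

Lemma Im_complexM z w : complex.Im (z * w) =
  complex.Re z * complex.Im w + complex.Im z * complex.Re w.
Proof. by case: z w => ? ? []. Qed.

Lemma normr_normc z : `|z| = (normc z)%:C.
Proof. by []. Qed.

Lemma normc_ge0 z : 0 <= normc z.
Proof. by case: z => a b; exact: sqrtr_ge0. Qed.

Lemma normc_gt0 z : (0 < normc z) = (z != 0).
Proof.
rewrite lt_neqAle normc_ge0 andbT eq_sym; congr (~~ _).
by apply/eqP/eqP => [/eq0_normc|->] //; exact: normc0.
Qed.

Lemma normc_real (x : R) : normc x%:C = `|x|.
Proof. by rewrite /= expr0n addr0 sqrtr_sqr. Qed.

Lemma ler_Re_normc z : `|complex.Re z| <= normc z.
Proof. by rewrite -lecR; exact: normc_ge_Re. Qed.

Lemma normc_rotate z : exists2 w, normc w = 1 & w * z = (normc z)%:C.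
Proof.
have [->|z0] := eqVneq z 0.
  by exists 1; rewrite ?normc1// mul1r normc0.
exists ((normc z)%:C / z); last by rewrite divfK.
rewrite normcM normcV normc_real ger0_norm ?normc_ge0// divff//.
by rewrite gt_eqF// normc_gt0.
Qed.

End ComplexParts.

Section ComplexExponential.
Context {R : realType}.
Implicit Types z w : R[i].

Lemma cexpD z w : cexp (z + w) = cexp z * cexp w.
Proof.
case: z w => [a b] [c d]; rewrite /cexp/= expRD cosD sinD.
by apply/eqP; rewrite eq_complex/=; apply/andP; split; apply/eqP; ring.
Qed.

Lemma cexp_real (x : R) : cexp x%:C = (expR x)%:C.
Proof. by rewrite /cexp/= cos0 sin0 mulr1. Qed.

Lemma cexp0 : cexp 0 = 1 :> R[i].
Proof. by rewrite cexp_real expR0. Qed.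

Lemma cexp_sum (I : Type) (r : seq I) (P : pred I) (F : I -> R[i]) :
  cexp (\sum_(i <- r | P i) F i) = \prod_(i <- r | P i) cexp (F i).
Proof. exact: (big_morph _ cexpD cexp0). Qed.

Lemma normc_cexp z : normc (cexp z) = expR (complex.Re z).
Proof.
by rewrite normcM normc_real ger0_norm ?expR_ge0//= cos2Dsin2 sqrtr1 mulr1.
Qed.

End ComplexExponential.

Section ComplexDerivative.
Context {R : realType}.
Implicit Types (f g : R -> R[i]) (x : R) (d w : R[i]).

Definition is_cderive x f d : Prop :=
  is_derive x 1 (fun y => complex.Re (f y)) (complex.Re d) /\
  is_derive x 1 (fun y => complex.Im (f y)) (complex.Im d).

Lemma is_cderive_eq x f d d' : is_cderive x f d -> d = d' -> is_cderive x f d'.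
Proof. by move=> ? <-. Qed.

Lemma is_cderive_cst w x : is_cderive x (fun=> w) 0.
Proof. by split; exact: is_derive_cst. Qed.

Lemma is_cderive_real (F : R -> R) (dF : R) x :
  is_derive x 1 F dF -> is_cderive x (fun y => (F y)%:C) dF%:C.
Proof. by split; last exact: is_derive_cst. Qed.

Lemma is_cderiveD x f g (df dg : R[i]) :
  is_cderive x f df -> is_cderive x g dg ->
  is_cderive x (fun y => f y + g y) (df + dg).
Proof.
move=> [f1 f2] [g1 g2]; split; rewrite (Re_complexD, Im_complexD).
- by under eq_fun do rewrite Re_complexD; exact: is_deriveD.
- by under eq_fun do rewrite Im_complexD; exact: is_deriveD.
Qed.

Lemma is_cderiveM x f g (df dg : R[i]) :
  is_cderive x f df -> is_cderive x g dg ->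
  is_cderive x (fun y => f y * g y) (df * g x + f x * dg).
Proof.
move=> [f1 f2] [g1 g2]; split.
- under eq_fun do rewrite Re_complexM.
  apply: (is_derive_eq (is_deriveB (is_deriveM f1 g1) (is_deriveM f2 g2))).
  by rewrite Re_complexD !Re_complexM /GRing.scale/=; ring.
- under eq_fun do rewrite Im_complexM.
  apply: (is_derive_eq (is_deriveD (is_deriveM f1 g2) (is_deriveM f2 g1))).
  by rewrite Im_complexD !Im_complexM /GRing.scale/=; ring.
Qed.

Lemma is_cderiveZ x f d w :
  is_cderive x f d -> is_cderive x (fun y => w * f y) (w * d).
Proof.
move=> fd; apply: (is_cderive_eq (is_cderiveM (is_cderive_cst w x) fd)).
by rewrite mul0r add0r.
Qed.

Lemma is_cderive_sum (I : Type) (r : seq I) x (f : I -> R -> R[i])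
    (df : I -> R[i]) :
  (forall i, is_cderive x (f i) (df i)) ->
  is_cderive x (fun y => \sum_(i <- r) f i y) (\sum_(i <- r) df i).
Proof.
move=> fdf; elim: r => [|i r IHr].
  by under eq_fun do rewrite big_nil; rewrite big_nil; exact: is_cderive_cst.
by under eq_fun do rewrite big_cons; rewrite big_cons; exact: is_cderiveD.
Qed.

Lemma is_cderive_cexp x f d : is_cderive x f d ->
  is_cderive x (fun y => cexp (f y)) (d * cexp (f x)).
Proof.
move=> [f1 f2].
have dexp : is_cderive x (fun y => (expR (complex.Re (f y)))%:C)
    (expR (complex.Re (f x)) * complex.Re d)%:C.
  by apply: is_cderive_real; exact: (@is_derive1_comp R expR).
have dcis : is_cderive x
    (fun y => cos (complex.Im (f y)) +i* sin (complex.Im (f y)))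
    (- sin (complex.Im (f x)) * complex.Im d +i*
      (cos (complex.Im (f x)) * complex.Im d)).
  split; first exact: (@is_derive1_comp R (@cos R)).
  exact: (@is_derive1_comp R (@sin R)).
apply: (is_cderive_eq (is_cderiveM dexp dcis)).
case: d {f1 f2 dexp dcis} => a b; apply/eqP.
by rewrite /cexp eq_complex/=; apply/andP; split; apply/eqP; ring.
Qed.

End ComplexDerivative.

Section MeanValueInequality.
Context {R : realType}.
Implicit Types (f g : R -> R[i]) (A a : R -> R).

(* Rotating f y - f x onto the positive real axis reduces the claim to the    *)
(* monotonicity of the real function A - Re (w f).                            *)
Lemma normc_increment_le f g A a (x y : R) : x <= y ->
  (forall t, x <= t <= y -> is_cderive t f (g t)) ->
  (forall t, x <= t <= y -> is_derive t 1 A (a t)) ->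
  (forall t, x <= t <= y -> normc (g t) <= a t) ->
  normc (f y - f x) <= A y - A x.
Proof.
move=> xy fg Aa ga; have [w w1 wf] := normc_rotate (f y - f x).
pose D t := A t - complex.Re (w * f t).
have dD t : x <= t <= y -> is_derive t 1 D (a t - complex.Re (w * g t)).
  move=> xty; apply: is_deriveB; first exact: Aa.
  exact: (is_cderiveZ w (fg _ xty)).1.
have : D x <= D y.
  apply: (ger0_derive1_ndecr (a := x) (b := y)) => //.
  - move=> t; rewrite in_itv => /andP[/ltW xt /ltW ty].
    by have [] := dD t; rewrite ?xt.
  - move=> t; rewrite in_itv => /andP[/ltW xt /ltW ty].
    have xty : x <= t <= y by rewrite xt.
    have tD := dD t xty; rewrite derive1E derive_val subr_ge0.
    rewrite (le_trans (ler_norm _))// (le_trans (ler_Re_normc _))//.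
    by rewrite normcM w1 mul1r ga.
  - by apply: derivable_within_continuous => t; rewrite in_itv => /dD[].
have : complex.Re (w * f y) - complex.Re (w * f x) = normc (f y - f x).
  by rewrite -raddfB/= -mulrBr wf.
by rewrite /D; lra.
Qed.

Lemma normc_increment_le_cst f g (D x y : R) : x <= y ->
  (forall t, is_cderive t f (g t)) ->
  (forall t, x <= t <= y -> normc (g t) <= D) ->
  normc (f y - f x) <= D * (y - x).
Proof.
move=> xy fg gD; rewrite mulrBr.
have dD (t : R) : is_derive t 1 (fun t => D * t) D.
  exact: (is_derive_eq (is_deriveZ _ (@is_derive_id R R t 1)) (mulr1 _)).
exact: (normc_increment_le xy (fun t _ => fg t) (fun t _ => dD t)).
Qed.

End MeanValueInequality.

Section RiemannSum.
Context {R : realType} (F f g : R -> R[i]) (A a : R -> R) (h : R).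
Hypotheses (h_ge0 : 0 <= h) (Ff : forall x, is_cderive x F (f x))
  (fg : forall x, is_cderive x f (g x))
  (Aa : forall x : R, is_derive x 1 A (a x))
  (ga : forall x, normc (g x) <= a x).

(* The error is the increment over the cell of F t - t f x, whose derivative  *)
(* f t - f x is dominated by the variation of A.                              *)
Lemma riemann_cell_le (x : R) :
  normc (h%:C * f x - (F (x + h) - F x)) <= h * (A (x + h) - A x).
Proof.
have variation u v : u <= v -> normc (f v - f u) <= A v - A u.
  by move=> uv; exact: (@normc_increment_le _ f g A a).
pose G t := F t + - f x * t%:C.
have dG t : is_cderive t G (f t - f x).
  apply: (is_cderive_eq (is_cderiveD (Ff t) (is_cderiveZ (- f x)
    (is_cderive_real (@is_derive_id R R t 1))))).
  by rewrite mulr1.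
have -> : h%:C * f x - (F (x + h) - F x) = - (G (x + h) - G x).
  by rewrite /G rmorphD/=; ring.
rewrite (normcN (G (x + h) - G x)).
have -> : h * (A (x + h) - A x) = (A (x + h) - A x) * (x + h - x) by ring.
apply: normc_increment_le_cst dG _; first by rewrite lerDl.
move=> t /andP[xt th]; rewrite (le_trans (variation _ _ xt))// lerD2r -subr_ge0.
exact: le_trans (normc_ge0 _) (variation _ _ th).
Qed.

Lemma riemann_sum_le (x0 : R) (n : nat) :
  normc (\sum_(z < n) h%:C * f (x0 + z%:R * h) - (F (x0 + n%:R * h) - F x0)) <=
    h * (A (x0 + n%:R * h) - A x0).
Proof.
elim: n => [|n IHn].
  by rewrite big_ord0 mul0r addr0 !subrr normc0 mulr0.
rewrite big_ord_recr/= -[in F (_ + n.+1%:R * h)]natr1.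
rewrite -[in A (_ + n.+1%:R * h)]natr1 mulrDl mul1r addrA.
set x := x0 + n%:R * h; have -> : h * (A (x + h) - A x0) =
    h * (A x - A x0) + h * (A (x + h) - A x) by ring.
have -> (S : R[i]) : S + h%:C * f x - (F (x + h) - F x0) =
    (S - (F x - F x0)) + (h%:C * f x - (F (x + h) - F x)) by ring.
by rewrite (le_trans (le_normcD _ _))// lerD// riemann_cell_le.
Qed.

End RiemannSum.

(** * Riemann sums of complex Gaussians *)

Section GaussianDistribution.
Context {R : realType}.
Implicit Types x : R.

Definition gauss_sdev : R := (Num.sqrt (2 * pi))^-1.

Lemma gauss_sdev_neq0 : gauss_sdev != 0.
Proof. by rewrite invr_eq0 gt_eqF// sqrtr_gt0 mulr_gt0// pi_gt0. Qed.

Lemma normal_pdf_gauss x : normal_pdf 0 gauss_sdev x = expR (- (pi * x ^+ 2)).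
Proof.
have pi0 : pi != 0 :> R by rewrite gt_eqF// pi_gt0.
have s2 : gauss_sdev ^+ 2 = (2 * pi)^-1.
  by rewrite exprVn sqr_sqrtr// mulr_ge0// pi_ge0.
rewrite normal_pdfE ?gauss_sdev_neq0// /normal_peak /normal_fun s2 subr0.
move: (pi : R) pi0 => p p0; rewrite [X in Num.sqrt X](_ : _ = 1); last by field.
by rewrite sqrtr1 invr1 mul1r; congr expR; field.
Qed.

Definition gauss_cdf x : R :=
  \int[lebesgue_measure]_(t in `]-oo, x]) normal_pdf 0 gauss_sdev t.

Lemma is_derive_gauss_cdf x : is_derive x 1 gauss_cdf (expR (- (pi * x ^+ 2))).
Proof.
rewrite -normal_pdf_gauss.
have [||||dF F'] :=
  @continuous_FTC1 R (normal_pdf 0 gauss_sdev) -oo%O x (x + 1).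
- by rewrite ltrDl.
- exact: integrableS (integrable_normal_pdf _ _).
- exact: ltNyr.
- by apply: continuous_normal_pdf; exact: gauss_sdev_neq0.
by apply: (DeriveDef dF); rewrite -derive1E.
Qed.

Let id_rv : measurableTypeR R -> R := idfun.

#[local] HB.instance Definition _ :=
  @isMeasurableFun.Build _ _ _ _ id_rv (@measurable_id _ _ setT).

Lemma gauss_cdfE :
  gauss_cdf = fine \o cdf (id_rv : {RV normal_prob 0 gauss_sdev >-> R}).
Proof. by []. Qed.

Lemma cvg_gauss_cdf_itv :
  gauss_cdf n%:R - gauss_cdf (- n%:R) @[n --> \oo] --> (1 : R).
Proof.
have cdfy : gauss_cdf x @[x --> +oo] --> (1 : R).
  by rewrite gauss_cdfE; apply: fine_cvg; exact: cvg_cdfy1.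
have cdfNy : gauss_cdf x @[x --> -oo] --> (0 : R).
  by rewrite gauss_cdfE; apply: fine_cvg; exact: cvg_cdfNy0.
rewrite -[X in _ --> X]subr0; apply: cvgB.
  exact: cvg_comp cvgr_idn cdfy.
by apply: (cvg_comp _ _ _ cdfNy); apply/cvgNrNy; exact: cvgr_idn.
Qed.

End GaussianDistribution.

Section ComplexGaussian.
Context {R : realType}.
Implicit Types (s t u v z w P : R[i]) (x c d C M K : R) (f : R -> R[i]).

Definition quad_decay C f : Prop :=
  forall x, normc (f x) <= C / (1 + x ^+ 2).

Lemma quad_decay_ge0 C f : quad_decay C f -> 0 <= C.
Proof.
by move=> /(_ 0) /(le_trans (normc_ge0 _)); rewrite expr0n addr0 divr1.
Qed.

Definition cgauss s t x : R[i] := cexp (- (pi%:C * (s * x%:C + t) ^+ 2)).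

Definition flux u v s t x : R[i] := (u * x%:C + v) * cgauss s t x.

Definition dflux u v s t x : R[i] :=
  (u - 2 * pi%:C * s * (s * x%:C + t) * (u * x%:C + v)) * cgauss s t x.

Definition d2flux u v s t x : R[i] :=
  ((2 * pi%:C * s * (s * x%:C + t)) ^+ 2 * (u * x%:C + v) -
   2 * pi%:C * s * (s * (u * x%:C + v) + 2 * u * (s * x%:C + t))) *
  cgauss s t x.

Lemma is_cderive_affine u v x : is_cderive x (fun y => u * y%:C + v) u.
Proof.
apply: (is_cderive_eq (is_cderiveD (is_cderiveZ u
  (is_cderive_real (@is_derive_id R R x 1))) (is_cderive_cst v x))).
by rewrite mulr1 addr0.
Qed.

Lemma is_cderive_cexp_sqr (w : R -> R[i]) (dw : R[i]) x : is_cderive x w dw ->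
  is_cderive x (fun y => cexp (- (pi%:C * w y ^+ 2)))
    (- (2 * pi%:C * dw * w x) * cexp (- (pi%:C * w x ^+ 2))).
Proof.
move=> wdw; have sqrE y : - (pi%:C * w y ^+ 2) = - pi%:C * (w y * w y).
  by rewrite mulNr expr2.
under eq_fun do rewrite sqrE; rewrite sqrE.
apply: (is_cderive_eq (is_cderive_cexp
  (is_cderiveZ (- pi%:C) (is_cderiveM wdw wdw)))).
by move: pi%:C => p; ring.
Qed.

Lemma is_cderive_flux u v s t x : is_cderive x (flux u v s t) (dflux u v s t x).
Proof.
apply: (is_cderive_eq (is_cderiveM (is_cderive_affine u v x)
  (is_cderive_cexp_sqr (is_cderive_affine s t x)))).
by rewrite /dflux /cgauss; move: pi%:C => p; ring.
Qed.

Lemma is_cderive_dflux u v s t x :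
  is_cderive x (dflux u v s t) (d2flux u v s t x).
Proof.
have dfactor := is_cderiveD (is_cderive_cst u x)
  (is_cderiveZ (- (2 * pi%:C * s))
    (is_cderiveM (is_cderive_affine s t x) (is_cderive_affine u v x))).
have /funext-> : dflux u v s t =1 fun y => (u + - (2 * pi%:C * s) *
    ((s * y%:C + t) * (u * y%:C + v))) * cgauss s t y.
  by move=> y; rewrite /dflux; move: pi%:C => p; ring.
apply: (is_cderive_eq (is_cderiveM dfactor
  (is_cderive_cexp_sqr (is_cderive_affine s t x)))).
by rewrite /d2flux /cgauss; move: pi%:C => p; ring.
Qed.

(* Moving the parameters (s, t) of s * cgauss s t in the direction (u, v)     *)
(* changes it by an x-derivative, so its integral over x does not change.     *)
Lemma is_cderive_deform (s t : R -> R[i]) u v x (r : R) :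
  is_cderive r s u -> is_cderive r t v ->
  is_cderive r (fun y => s y * cgauss (s y) (t y) x) (dflux u v (s r) (t r) x).
Proof.
move=> su tv; have dw : is_cderive r (fun y => s y * x%:C + t y) (u * x%:C + v).
  under eq_fun do rewrite mulrC; rewrite mulrC.
  exact: is_cderiveD (is_cderiveZ _ su) tv.
apply: (is_cderive_eq (is_cderiveM su (is_cderive_cexp_sqr dw))).
by rewrite /dflux /cgauss; move: pi%:C => p; ring.
Qed.

Lemma Re_sqr_affine_ge s t x d M :
  normc s <= M -> normc t <= M -> d <= complex.Re (s ^+ 2) ->
  d * `|x| ^+ 2 - 2 * M ^+ 2 * `|x| - M ^+ 2 <=
    complex.Re ((s * x%:C + t) ^+ 2).
Proof.
move=> sM tM sd; set y : R := `|x|; have y0 : 0 <= y := normr_ge0 x.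
have Re_le z w : normc z <= M -> normc w <= M ->
    `|complex.Re (z * w)| <= M ^+ 2.
  move=> zM wM; rewrite (le_trans (ler_Re_normc _))// normcM expr2.
  by rewrite ler_pM ?normc_ge0.
have -> : complex.Re ((s * x%:C + t) ^+ 2) =
    complex.Re (s ^+ 2) * y ^+ 2 + 2 * (x * complex.Re (s * t)) +
    complex.Re (t * t).
  rewrite /y real_normK ?num_real//.
  by case: s t {sM tM sd} => a b [a' b'] /=; ring.
have cross : - (y * M ^+ 2) <= x * complex.Re (s * t).
  by rewrite lerNl (le_trans (ler_norm _))// normrN normrM ler_wpM2l ?Re_le.
have lead : d * y ^+ 2 <= complex.Re (s ^+ 2) * y ^+ 2.
  by rewrite ler_wpM2r ?sqr_ge0.
have := Re_le t t tM tM; rewrite ler_norml => /andP[? _].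
by lra.
Qed.

Lemma cgauss_decay (n : nat) d M : 0 < d -> exists K : R,
  forall s t x, normc s <= M -> normc t <= M -> d <= complex.Re (s ^+ 2) ->
  normc (cgauss s t x) * (1 + `|x|) ^+ n <= K.
Proof.
move=> d0; rewrite /cgauss; move: (pi : R) (@pi_gt0 R) => p p0.
pose B := 2 * p * M ^+ 2 + n%:R.
exists (expR (B ^+ 2 / (4 * p * d) + p * M ^+ 2 + n%:R)) => s t x sM tM sd.
have := Re_sqr_affine_ge x sM tM sd; rewrite -(ler_pM2l p0).
set y : R := `|x| => Re_ge; have y0 : 0 <= y := normr_ge0 x.
have power_le : (1 + y) ^+ n <= expR (n%:R * (1 + y)).
  rewrite expRM_natl lerXn2r ?nnegrE ?addr_ge0 ?expR_ge0// -subr_ge0.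
  by have := expR_ge1Dx (1 + y); lra.
have quad : B * y - p * d * y ^+ 2 <= B ^+ 2 / (4 * p * d).
  rewrite -subr_ge0 (_ : _ - _ = (B - 2 * p * d * y) ^+ 2 / (4 * p * d)).
    by rewrite divr_ge0 ?sqr_ge0// !mulr_ge0// ltW.
  by field; rewrite !gt_eqF.
rewrite normc_cexp (le_trans (ler_wpM2l (expR_ge0 _) power_le))//.
rewrite -expRD ler_expR raddfN/= -[complex.Re _]/(complex.Re (p%:C * _)).
rewrite Re_complexM/= mul0r subr0.
by move: quad Re_ge; rewrite /B; lra.
Qed.

Lemma normc_affine_le z w x M : normc z <= M -> normc w <= M ->
  normc (z * x%:C + w) <= M * (1 + `|x|).
Proof.
move=> zM wM; rewrite (le_trans (le_normcD _ _))// mulrDr mulr1 addrC lerD//.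
by rewrite normcM normc_real ler_wpM2r.
Qed.

Lemma mul_cgauss_le P s t x (c K : R) : 0 <= c ->
  normc P <= c * (1 + `|x|) ^+ 3 ->
  normc (cgauss s t x) * (1 + `|x|) ^+ 5 <= K ->
  normc (P * cgauss s t x) <= c * K / (1 + x ^+ 2).
Proof.
move=> c0 Pc EK; set E := cgauss s t x in EK *; set Q := 1 + `|x| in Pc EK.
have x2 : 1 + x ^+ 2 <= Q ^+ 2.
  by rewrite -[x ^+ 2]real_normK ?num_real// /Q; have := normr_ge0 x; lra.
have x0 : 0 < 1 + x ^+ 2 by rewrite ltr_pwDl// sqr_ge0.
rewrite normcM ler_pdivlMr//.
apply: (@le_trans _ _ (c * Q ^+ 3 * normc E * Q ^+ 2)).
  by apply: ler_pM (ltW x0) _ x2; rewrite ?mulr_ge0 ?ler_wpM2r ?normc_ge0.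
have -> : c * Q ^+ 3 * normc E * Q ^+ 2 = c * (normc E * Q ^+ 5) by ring.
exact: ler_wpM2l.
Qed.

Lemma d2flux_factor_le (k s u w z : R[i]) (p M Q : R) : 1 <= Q ->
  normc k <= p -> normc s <= M -> normc u <= M ->
  normc w <= M * Q -> normc z <= M * Q ->
  normc ((k * s * w) ^+ 2 * z - k * s * (s * z + 2 * u * w)) <=
    (p ^+ 2 * M ^+ 5 + 3 * p * M ^+ 3) * Q ^+ 3.
Proof.
move=> Q1 kp sM uM wM zM.
have Q0 : 0 <= Q by exact: le_trans Q1.
have p0 : 0 <= p := le_trans (normc_ge0 k) kp.
have M0 : 0 <= M := le_trans (normc_ge0 s) sM.
have prod_le z1 z2 a b : normc z1 <= a -> normc z2 <= b ->
    normc (z1 * z2) <= a * b.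
  by move=> z1a z2b; rewrite normcM ler_pM ?normc_ge0.
have sum_le z1 z2 a b : normc z1 <= a -> normc z2 <= b ->
    normc (z1 + z2) <= a + b.
  by move=> z1a z2b; rewrite (le_trans (le_normcD _ _))// lerD.
have n2 : normc (2 * u : R[i]) <= 2 * M.
  by rewrite mulr_natl mulr2n [leRHS]mulr_natl mulr2n sum_le.
have quadratic := prod_le _ _ _ _ (prod_le _ _ _ _ kp sM) wM.
have linear := prod_le _ _ _ _ (prod_le _ _ _ _ kp sM)
  (sum_le _ _ _ _ (prod_le _ _ _ _ sM zM) (prod_le _ _ _ _ n2 wM)).
have := sum_le _ (- (k * s * (s * z + 2 * u * w))) _ _
  (prod_le _ _ _ _ (prod_le _ _ _ _ quadratic quadratic) zM).
rewrite (normcN (k * s * (s * z + 2 * u * w))) => /(_ _ linear).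
rewrite -expr2 => /le_trans; apply.
have QQ3 : Q <= Q ^+ 3 by rewrite -[leLHS]expr1 ler_weXn2l.
have : 3 * p * M ^+ 3 * Q <= 3 * p * M ^+ 3 * Q ^+ 3.
  by rewrite ler_wpM2l// !mulr_ge0// exprn_ge0.
by lra.
Qed.

Lemma flux_decay d M : 0 < d -> exists C : R,
  forall u v s t, normc u <= M -> normc v <= M -> normc s <= M ->
    normc t <= M -> d <= complex.Re (s ^+ 2) ->
  quad_decay C (flux u v s t) /\ quad_decay C (d2flux u v s t).
Proof.
move=> d0; have [K decay] := cgauss_decay 5 M d0.
pose p := normc (2 * pi%:C : R[i]); have p0 : 0 <= p := normc_ge0 _.
pose c2 := p ^+ 2 * M ^+ 5 + 3 * p * M ^+ 3; exists ((M + c2) * K).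
move=> u v s t uM vM sM tM sd.
have M0 : 0 <= M := le_trans (normc_ge0 s) sM.
have c20 : 0 <= c2.
  rewrite addr_ge0 ?(mulr_ge0 _ (exprn_ge0 _ M0)) ?exprn_ge0//.
  exact: mulr_ge0.
split=> x; apply: (mul_cgauss_le (addr_ge0 M0 c20) _ (decay _ _ _ sM tM sd));
  set Q := 1 + `|x|; have Q1 : 1 <= Q by rewrite lerDl.
- rewrite (le_trans (normc_affine_le x uM vM))// -/Q mulrDl.
  apply: ler_wpDr; first by rewrite mulr_ge0// exprn_ge0// (le_trans _ Q1).
  by rewrite ler_wpM2l// -[leLHS]expr1 ler_weXn2l.
- rewrite (le_trans (d2flux_factor_le Q1 (lexx _) sM uM
    (normc_affine_le x sM tM) (normc_affine_le x uM vM)))// -/Q [leRHS]mulrDl.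
  by apply: ler_wpDl => //; rewrite mulr_ge0// exprn_ge0// (le_trans _ Q1).
Qed.

End ComplexGaussian.

Section GridSum.
Context {R : realType}.
Implicit Types (F f g : R -> R[i]) (s t u v : R[i]) (x C d e M : R) (m : nat).

(* For H' = 2 m the points grid m z with z < 4 m ^ 2 form the lattice L'.     *)
Definition grid m (z : nat) : R := - m%:R + z%:R * (2 * m%:R)^-1.

Definition grid_sum m f : R[i] :=
  \sum_(z < 4 * m ^ 2) (2 * m%:R)^-1%:C * f (grid m z).

Lemma grid_end m : (0 < m)%N -> grid m (4 * m ^ 2) = m%:R.
Proof.
move=> m0; rewrite /grid natrM natrX; field.
by rewrite pnatr_eq0 -lt0n.
Qed.

Lemma near_infty_divn_lt C e : 0 < e -> \forall m \near \oo, C / m%:R < e.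
Proof.
move=> e0; near=> m.
have m0 : 0 < m%:R :> R by near: m; exact: nbhs_infty_gtr.
rewrite ltr_pdivrMr// mulrC -ltr_pdivrMr//.
by near: m; exact: nbhs_infty_gtr.
Unshelve. all: by end_near. Qed.

Lemma grid_sum_cderive_le F f g C m : (0 < m)%N ->
  (forall x, is_cderive x F (f x)) -> (forall x, is_cderive x f (g x)) ->
  quad_decay C g ->
  normc (grid_sum m f - (F m%:R - F (- m%:R))) <= 2 * C / m%:R.
Proof.
move=> m0 Ff fg gC; have mR : 0 < m%:R :> R by rewrite ltr0n.
have C0 := quad_decay_ge0 gC.
have h0 : 0 <= (2 * m%:R)^-1 :> R by rewrite invr_ge0 mulr_ge0.
have datan x : is_derive x 1 (fun x => C * atan x) (C / (1 + x ^+ 2)).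
  exact: (@is_deriveZ R R R atan C x 1).
have := riemann_sum_le h0 Ff fg datan gC (- m%:R) (4 * m ^ 2).
rewrite -/(grid _ _) grid_end// => /le_trans; apply.
have -> : 2 * C / m%:R = (2 * m%:R)^-1 * (C * 4) by field; rewrite gt_eqF.
rewrite -mulrBr !ler_wpM2l//.
by have := @atan_ltpi2 R m%:R; have := @atan_gtNpi2 R (- m%:R);
  have := @pihalf_lt2 R; lra.
Qed.

Lemma cgauss10E x : cgauss 1 0 x = (expR (- (pi * x ^+ 2)))%:C.
Proof.
by rewrite /cgauss mul1r addr0 -rmorphXn -rmorphM -rmorphN cexp_real.
Qed.

Lemma grid_sum_cgauss10_near e : 0 < e ->
  \forall m \near \oo, normc (grid_sum m (cgauss 1 0) - 1) < e.
Proof.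
move=> e0; pose p : R[i] := 2 * pi%:C.
have dcdf x : is_cderive x (fun y => (gauss_cdf y)%:C) (cgauss 1 0 x).
  by rewrite cgauss10E; apply: is_cderive_real; exact: is_derive_gauss_cdf.
have dgauss x : is_cderive x (cgauss 1 0) (flux (- p) 0 1 0 x).
  apply: (is_cderive_eq (is_cderive_cexp_sqr (is_cderive_affine 1 0 x))).
  by congr (_ * _); rewrite /p; move: pi%:C => q; ring.
have [C decay] := @flux_decay R 1 (1 + normc p) ltr01.
have dgauss_le : quad_decay C (flux (- p) 0 1 0).
  apply: (decay _ _ _ _ _ _ _ _ _).1;
    by rewrite ?(normcN p) ?normc0 ?normc1 ?expr1n ?lerDl ?lerDr ?addr_ge0
      ?normc_ge0.
have e2 : 0 < e / 2 by rewrite divr_gt0.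
near=> m; have m0 : (0 < m)%N by near: m; exact: nbhs_infty_gt.
rewrite (_ : _ - 1 = (grid_sum m (cgauss 1 0) -
    ((gauss_cdf m%:R)%:C - (gauss_cdf (- m%:R))%:C)) +
  (gauss_cdf m%:R - gauss_cdf (- m%:R) - 1)%:C); last first.
  by rewrite !rmorphB/=; ring.
rewrite (le_lt_trans (le_normcD _ _))// (splitr e) ltrD//.
  apply: (le_lt_trans (grid_sum_cderive_le m0 dcdf dgauss dgauss_le)).
  by near: m; exact: near_infty_divn_lt.
rewrite normc_real distrC; near: m.
by move/cvgrPdist_lt : (@cvg_gauss_cdf_itv R); apply.
Unshelve. all: by end_near. Qed.

Lemma grid_sum_dflux_le u v s t C m : (0 < m)%N ->
  quad_decay C (flux u v s t) -> quad_decay C (d2flux u v s t) ->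
  normc (grid_sum m (dflux u v s t)) <= 4 * C / m%:R.
Proof.
move=> m0 fluxC d2fluxC; have mR : 0 < m%:R :> R by rewrite ltr0n.
have C0 := quad_decay_ge0 fluxC.
have end_le x : x ^+ 2 = m%:R ^+ 2 -> normc (flux u v s t x) <= C / m%:R.
  move=> xm; apply: le_trans (fluxC x) _; rewrite ler_wpM2l//.
  rewrite lef_pV2 ?posrE ?ltr_pwDl ?sqr_ge0// xm -natrX.
  by rewrite nat1r ler_nat; nia.
have := grid_sum_cderive_le m0 (is_cderive_flux u v s t)
  (is_cderive_dflux u v s t) d2fluxC.
set S := grid_sum _ _; set F := flux u v s t => S_le.
have -> : S = (S - (F m%:R - F (- m%:R))) + (F m%:R - F (- m%:R)) by ring.
rewrite (le_trans (le_normcD _ _))//.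
have := le_normcD (F m%:R) (- F (- m%:R)); rewrite (normcN (F (- m%:R))).
have := end_le m%:R erefl; have := end_le (- m%:R) (sqrrN _).
move: S_le; rewrite -/F; lra.
Qed.

Lemma grid_sum_deform_le u v C m : (0 < m)%N ->
  (forall r, 0 <= r <= 1 -> quad_decay C (flux u v (1 + u * r%:C) (v * r%:C)) /\
    quad_decay C (d2flux u v (1 + u * r%:C) (v * r%:C))) ->
  normc (grid_sum m (fun x => (1 + u) * cgauss (1 + u) v x) -
    grid_sum m (cgauss 1 0)) <= 4 * C / m%:R.
Proof.
move=> m0 decay.
pose s (r : R) : R[i] := 1 + u * r%:C; pose t (r : R) : R[i] := v * r%:C.
pose S r := grid_sum m (fun x => s r * cgauss (s r) (t r) x).
pose dS r := grid_sum m (dflux u v (s r) (t r)).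
have dSE (r : R) : is_cderive r S (dS r).
  apply: is_cderive_sum => z; apply/is_cderiveZ/is_cderive_deform.
  - rewrite /s; under eq_fun do rewrite addrC; exact: is_cderive_affine.
  - rewrite /t; under eq_fun do rewrite -[_ * _]addr0; exact: is_cderive_affine.
have dS_le r : 0 <= r <= 1 -> normc (dS r) <= 4 * C / m%:R.
  by move=> /decay[]; exact: grid_sum_dflux_le.
have := normc_increment_le_cst ler01 dSE dS_le.
rewrite subr0 mulr1; congr (normc (_ - _) <= _).
  by apply: eq_bigr => z _; rewrite /s /t !mulr1.
by apply: eq_bigr => z _; rewrite /s /t !mulr0 addr0 mul1r.
Qed.

Lemma Re_sqr_segment_ge s d (r : R) : 0 <= d <= 1 ->
  d <= complex.Re s - complex.Im s -> d <= complex.Re s + complex.Im s ->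
  0 <= r <= 1 -> d ^+ 2 <= complex.Re ((1 + (s - 1) * r%:C) ^+ 2).
Proof.
move=> /andP[d0 d1] sBd sDd /andP[r0 r1].
have -> : complex.Re ((1 + (s - 1) * r%:C) ^+ 2) =
    ((1 - r) + r * (complex.Re s - complex.Im s)) *
    ((1 - r) + r * (complex.Re s + complex.Im s)).
  by case: s {sBd sDd} => a b /=; ring.
by rewrite expr2; apply: ler_pM => //; nra.
Qed.

Lemma grid_sum_cgauss_near M d e : 0 < d -> 0 < e -> \forall m \near \oo,
  forall s t, normc s <= M -> normc t <= M ->
    d <= complex.Re s - complex.Im s -> d <= complex.Re s + complex.Im s ->
  normc (grid_sum m (fun x => s * cgauss s t x) - 1) < e.
Proof.
move=> d0 e0; pose d1 := Num.min d 1.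
have d1_gt0 : 0 < d1 by rewrite lt_min d0 ltr01.
have [C decay] := flux_decay (2 + M) (exprn_gt0 2 d1_gt0).
have e2 : 0 < e / 2 by rewrite divr_gt0.
near=> m => s t sM tM sBd sDd.
have m0 : (0 < m)%N by near: m; exact: nbhs_infty_gt.
have M0 : 0 <= M := le_trans (normc_ge0 s) sM.
have s1M : normc (s - 1) <= 1 + M.
  by rewrite (le_trans (le_normcD _ _))// (normcN 1) normc1 addrC lerD2l.
have scaled_le z B (r : R) : normc z <= B -> 0 <= r <= 1 ->
    normc (z * r%:C) <= B.
  move=> zB /andP[r0 r1]; rewrite normcM normc_real ger0_norm//.
  by rewrite (le_trans _ zB)// ler_piMr ?normc_ge0.
have := @grid_sum_deform_le (s - 1) t C m m0.
rewrite addrCA subrr addr0 => deform_le.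
rewrite (_ : _ - 1 = (grid_sum m (fun x => s * cgauss s t x) -
    grid_sum m (cgauss 1 0)) + (grid_sum m (cgauss 1 0) - 1)); last by ring.
rewrite (le_lt_trans (le_normcD _ _))// (splitr e) ltrD//; last first.
  by near: m; exact: grid_sum_cgauss10_near.
apply: le_lt_trans (deform_le _) _; last by near: m; exact: near_infty_divn_lt.
move=> r r01; apply: decay.
- by rewrite (le_trans s1M)// lerD2r ler1n.
- by rewrite (le_trans tM)// lerDr.
- rewrite (le_trans (le_normcD _ _))// normc1.
  by rewrite [2]mulr2n -addrA lerD2l scaled_le.
- by rewrite (le_trans (scaled_le _ _ _ tM r01))// lerDr.
- have d1d : d1 <= d by rewrite ge_min lexx.
  apply: Re_sqr_segment_ge (le_trans d1d sBd) (le_trans d1d sDd) r01.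
  by rewrite (ltW d1_gt0) ge_min lexx orbT.
Unshelve. all: by end_near. Qed.

End GridSum.

(** * The transform over finite lattices *)

Section FiniteSupportBigop.
Context {S : Type} {idx : S} {op : Monoid.com_law idx}.

Lemma fsbig_fset (T : choiceType) (X : {fset T}) (F : T -> S) :
  \big[op/idx]_(x \in [set` X]) F x = \big[op/idx]_(x : X) F (val x).
Proof. by rewrite -fsbig_seq ?fset_uniq// big_seq_fsetE. Qed.

Lemma fsbig_fintype (T : finType) (F : T -> S) :
  \big[op/idx]_(x \in [set: T]) F x = \big[op/idx]_(x : T) F x.
Proof.
rewrite -[RHS]big_enum/= [RHS]fsbig_seq ?enum_uniq//; apply: eq_fsbigl.
by apply/seteqP; split => x //= _; rewrite mem_enum.
Qed.

End FiniteSupportBigop.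

Section ZeroExtendedFunctions.
Local Open Scope fset_scope.
Context {T : choiceType} {V : nmodType}.
Implicit Types (A : set T) (B : set V).

Definition zext_funs A B : set (T -> V) :=
  [set f | (forall k, A k -> B (f k)) /\ (forall k, ~ A k -> f k = 0)].

Definition zext (a : {fset T}) (b : {fset V}) (phi : {ffun a -> b}) (k : T) :
    V :=
  oapp (fun i => val (phi i)) 0 (insub k).

Lemma zext_val (a : {fset T}) (b : {fset V}) (phi : {ffun a -> b}) (k : a) :
  zext phi (val k) = val (phi k).
Proof. by rewrite /zext valK. Qed.

Lemma zext_inj (a : {fset T}) (b : {fset V}) : injective (@zext a b).
Proof.
by move=> phi psi e; apply/ffunP => k; apply: val_inj; rewrite -!zext_val e.
Qed.

Lemma zext_funs_image (a : {fset T}) (b : {fset V}) :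
  zext_funs [set` a] [set` b] = (@zext a b @` [set: {ffun a -> b}])%classic.
Proof.
apply/seteqP; split => [f [fb f0]|_ [phi _ <-]] /=.
- exists [ffun k : a => [` fb (val k) (valP k)]] => //; apply/funext => k.
  rewrite /zext; case: insubP => [i _ <-|/negP ka] /=; first by rewrite ffunE.
  by rewrite f0.
- split=> k.
  + by move=> ka; rewrite (zext_val phi [` ka]); exact: valP.
  + by move=> /negP ka; rewrite /zext insubN.
Qed.

Lemma finite_zext_funs A B :
  finite_set A -> finite_set B -> finite_set (zext_funs A B).
Proof.
move=> finA finB; rewrite -(fset_setK finA) -(fset_setK finB) zext_funs_image.
exact: finite_image.
Qed.

Lemma sum_zext_funs_prod (S : comNzRingType) A B (G : T -> V -> S) :
  finite_set A -> finite_set B ->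
  \sum_(f \in zext_funs A B) \big[*%R/1]_(k \in A) G k (f k) =
  \big[*%R/1]_(k \in A) \sum_(x \in B) G k x.
Proof.
move=> finA finB; rewrite -(fset_setK finA) -(fset_setK finB) zext_funs_image.
set a := fset_set A; set b := fset_set B.
rewrite fsbig_image; last by move=> ? ? _ _; exact: zext_inj.
rewrite fsbig_fintype fsbig_fset.
under [RHS]eq_bigr do rewrite fsbig_fset; rewrite bigA_distr_bigA.
apply: eq_bigr => phi _; rewrite fsbig_fset.
by apply: eq_bigr => k _; rewrite zext_val.
Qed.

End ZeroExtendedFunctions.

(* The lattices L and L' of the paper, with iota the embedding of the         *)
(* (hyper)integers Z0 into the (hyper)reals K.                                *)
Definition lattice (Z0 : Type) (K : numDomainType) (iota : Z0 -> K) (n : Z0) :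
    set K :=
  [set x | exists z, x = (iota n)^-1 * iota z /\
    - (iota n / 2) <= x < iota n / 2].

Section Lattice.
Context {R : realType}.
Implicit Types (m : nat) (n : int).
Local Notation lat := (@lattice int R intr).

Lemma grid_inj m : (0 < m)%N -> injective (@grid R m).
Proof.
move=> m0 x y /addrI /mulIf; rewrite invr_eq0 mulf_eq0 !pnatr_eq0/= -lt0n.
by move=> /(_ m0)/eqP; rewrite eqr_nat => /eqP.
Qed.

Lemma finite_lattice n : finite_set (lat n).
Proof.
pose N := (`|n| ^ 2)%N.
pose point (k : nat) : R := n%:~R^-1 * (k%:Z - N%:Z)%:~R.
apply: (@sub_finite_set _ _ (point @` `I_(N + N))); last exact: finite_image.
move=> x [z [xE /andP[lo up]]].
have n0 : 0 < n by rewrite -(@ltr0z R); move: (le_lt_trans lo up); lra.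
have nR : 0 < n%:~R :> R by rewrite ltr0z.
have z_lt : z < n * n.
  rewrite -(ltr_int R) rmorphM/=; move: up; rewrite xE mulrC ltr_pdivrMr//.
  by have := mulr_gt0 nR nR; lra.
have z_ge : - (n * n) <= z.
  rewrite -(ler_int R) rmorphN rmorphM/=; move: lo.
  rewrite xE [leRHS]mulrC ler_pdivlMr//.
  by have := mulr_gt0 nR nR; lra.
have nN : n * n = N%:Z by rewrite /N; nia.
rewrite nN in z_lt z_ge; exists (absz (z + N%:Z)).
  by rewrite /= -ltz_nat; lia.
by rewrite /point gez0_abs ?addrK//; lia.
Qed.

Lemma lattice_grid m : (0 < m)%N ->
  lat (2 * m)%:Z = @grid R m @` `I_(4 * m ^ 2).
Proof.
move=> m0; have mR : 0 < m%:R :> R by rewrite ltr0n.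
have m2E : (2 * m)%:Z%:~R = 2 * m%:R :> R by rewrite -natrM.
have gridE (z : nat) :
    grid m z = (2 * m%:R)^-1 * (z%:Z - (2 * m ^ 2)%:Z)%:~R :> R.
  rewrite intrD rmorphN/= /grid -!pmulrn natrM natrX.
  by field; rewrite gt_eqF.
apply/seteqP; split => [x|_ [z /= zm <-]].
- rewrite /lattice/= m2E => -[z [-> /andP[lo up]]].
  have h0 : 0 < 2 * m%:R :> R by rewrite mulr_gt0.
  rewrite [leRHS]mulrC ler_pdivlMr// in lo.
  rewrite [ltLHS]mulrC ltr_pdivrMr// in up.
  have z_ge : - (2 * m ^ 2)%:Z <= z.
    rewrite -(ler_int R) rmorphN/= -pmulrn natrM natrX; move: lo; lra.
  have z_lt : z < (2 * m ^ 2)%:Z.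
    rewrite -(ltr_int R) -pmulrn natrM natrX; move: up; lra.
  exists (absz (z + (2 * m ^ 2)%:Z)).
    by rewrite /= -ltz_nat gez0_abs; lia.
  by rewrite gridE gez0_abs ?addrK//; lia.
- exists (z%:Z - (2 * m ^ 2)%:Z); rewrite m2E; split; first exact: gridE.
  have -> : 2 * m%:R / 2 = m%:R :> R by field.
  rewrite /grid lerDl mulr_ge0 ?invr_ge0 ?mulr_ge0//=.
  rewrite addrC -ltrBrDr opprK ltr_pdivrMr ?mulr_gt0//.
  rewrite (_ : _ * _ = (4 * m ^ 2)%:R); last by rewrite natrM natrX; ring.
  by rewrite ltr_nat.
Qed.

Lemma fsbig_lattice (S : Type) (idx : S) (op : Monoid.com_law idx)
    (F : R -> S) m : (0 < m)%N ->
  \big[op/idx]_(k \in lat (2 * m)%:Z) F k =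
    \big[op/idx]_(z < 4 * m ^ 2) F (grid m z).
Proof.
move=> m0; rewrite lattice_grid// fsbig_image -?fsbig_ord// => x y _ _.
exact: grid_inj.
Qed.

End Lattice.

Definition pos_even {D : numDomainType} : set D :=
  [set x | 0 < x /\ exists k, x = 2 * k].

Lemma pos_even_int (n : int) :
  pos_even n -> exists2 m, (0 < m)%N & n = (2 * m)%:Z.
Proof. by move=> [n0 [k nE]]; exists (absz k); lia. Qed.

Lemma ler_norm_prodB (K : numDomainType) (n : nat) (F G : 'I_n -> K) (A d : K) :
  1 <= A -> (forall i, `|F i| <= A) -> (forall i, `|G i| <= A) ->
  (forall i, `|F i - G i| <= d) ->
  `|\prod_(i < n) F i - \prod_(i < n) G i| <= n%:R * A ^+ n * d.
Proof.
move=> A1; elim: n F G => [|n IHn] F G FA GA FG.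
  by rewrite !big_ord0 subrr normr0 !mul0r.
have A0 : 0 <= A := le_trans ler01 A1.
have d0 : 0 <= d := le_trans (normr_ge0 _) (FG ord_max).
have := IHn _ _ (fun i => FA (widen_ord (leqnSn n) i)) (fun i => GA _)
  (fun i => FG _).
rewrite !big_ord_recr/=.
set P := \prod_(i < n) _; set Q := \prod_(i < n) _ => PQ.
have QA : `|Q| <= A ^+ n.+1.
  rewrite normr_prod (@le_trans _ _ (\prod_(i < n) A))//.
    by apply: ler_prod => i _; rewrite normr_ge0 GA.
  by rewrite prodr_const card_ord ler_weXn2l.
set x := F ord_max; set y := G ord_max.
have -> : P * x - Q * y = (P - Q) * x + Q * (x - y) by ring.
rewrite (le_trans (ler_normD _ _))// !normrM -natr1 2!mulrDl mul1r.
have -> : n%:R * A ^+ n.+1 * d = n%:R * A ^+ n * d * A by rewrite exprS; ring.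
by rewrite lerD ?ler_pM ?FA ?FG.
Qed.

Section FiniteGaussianTransform.
Context {R : realType}.
Implicit Types (xi s : R[i]) (m : nat) (n : int) (b : R -> R).
Local Notation lat := (@lattice int R intr).

Definition finite_gauss xi n (c : R -> R[i]) : R[i] :=
  cexp (- (pi%:C * xi * \sum_(k \in lat n) c k ^+ 2)).

Definition finite_Bxi xi n n' b : R[i] :=
  \sum_(a \in zext_funs (lat n) (lat n')) (n'%:~R ^ (- n ^+ 2))%:C *
    finite_gauss xi n (fun k => (a k)%:C + 'i * xi^-1 * (b k)%:C).

Definition finite_FT_gauss xi n n' b : R[i] :=
  \sum_(a \in zext_funs (lat n) (lat n')) (n'%:~R ^ (- n ^+ 2))%:C *
    cexp (- (2 * pi%:C * 'i * (\sum_(k \in lat n) a k * b k)%:C)) *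
    finite_gauss xi n (fun k => (a k)%:C).

Lemma finite_FT_gaussE xi n n' b : xi != 0 ->
  finite_FT_gauss xi n n' b =
  finite_Bxi xi n n' b * finite_gauss xi n (fun k => (b k)%:C / xi).
Proof.
move=> xi0; rewrite mulr_fsuml; apply: eq_fsbigr => a _.
rewrite -[LHS]mulrA -[RHS]mulrA -!cexpD !(fsbig_finite _ _ (finite_lattice n)).
congr (_ * cexp _).
rewrite rmorph_sum !mulr_sumr -!sumrN -!big_split; apply: eq_bigr => k _ /=.
rewrite rmorphM/=; move: (a k)%:C (b k)%:C pi%:C => x y p.
have -> : (x + 'i * xi^-1 * y) ^+ 2 =
    x ^+ 2 + 2 * (x * ('i * xi^-1 * y)) + 'i ^+ 2 * (xi^-1 * y) ^+ 2 by ring.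
by rewrite sqr_i; field.
Qed.

Definition shifted_gauss xi (y x : R) : R[i] :=
  cexp (- (pi%:C * xi * (x%:C + 'i * xi^-1 * y%:C) ^+ 2)).

Lemma finite_Bxi_prod xi m m' b : (0 < m)%N -> (0 < m')%N ->
  finite_Bxi xi (2 * m)%:Z (2 * m')%:Z b =
  \prod_(z < 4 * m ^ 2) grid_sum m' (shifted_gauss xi (b (grid m z))).
Proof.
move=> m0 m'0.
pose G k x := (2 * m'%:R : R)^-1%:C * shifted_gauss xi (b k) x.
transitivity (\big[*%R/1]_(k \in lat (2 * m)%:Z)
    \sum_(x \in lat (2 * m')%:Z) G k x).
  rewrite -(sum_zext_funs_prod _ (finite_lattice _) (finite_lattice _)).
  apply: eq_fsbigr => a _; rewrite /finite_gauss !fsbig_lattice//.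
  rewrite mulr_sumr -sumrN cexp_sum [RHS]big_split/=; congr (_ * _).
  rewrite prodr_const card_ord -(rmorphXn (real_complex R))/=.
  congr (real_complex R _).
  have -> : - (2 * m)%:Z ^+ 2 = - (4 * m ^ 2)%:Z by rewrite !PoszM; ring.
  by rewrite -exprnN -pmulrn natrM exprVn.
by rewrite fsbig_lattice//; apply: eq_bigr => z _; rewrite fsbig_lattice.
Qed.

Lemma grid_sumZ m s (f : R -> R[i]) :
  grid_sum m (fun x => s * f x) = s * grid_sum m f.
Proof. by rewrite mulr_sumr; apply: eq_bigr => z _; rewrite mulrCA. Qed.

Lemma Re_gt0_neq0 xi : 0 < complex.Re xi -> xi != 0.
Proof. by apply: contraTneq => ->; rewrite ltxx. Qed.

Lemma Re_sqrtc_gt xi : 0 < complex.Re xi ->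
  `|complex.Im (sqrtc xi)| < complex.Re (sqrtc xi).
Proof.
move=> xi0.
have s0 : 0 <= complex.Re (sqrtc xi).
  by case: xi {xi0} => a b /=; exact: sqrtr_ge0.
move: xi0; rewrite -[xi in 0 < complex.Re xi]sqr_sqrtc expr2 Re_complexM.
rewrite -!expr2 subr_gt0 => sqr_lt.
by rewrite -(@ltr_pXn2r _ 2) ?nnegrE// real_normK ?num_real.
Qed.

Lemma shifted_gaussE xi y x : xi != 0 ->
  shifted_gauss xi y x = cgauss (sqrtc xi) ('i * y%:C / sqrtc xi) x.
Proof.
rewrite -sqrtc_eq0 -[in shifted_gauss xi](sqr_sqrtc xi) => s0.
congr (cexp (- _)); rewrite -mulrA; congr (_ * _); field.
exact: s0.
Qed.

Lemma grid_sum_shifted_gauss_near xi (b0 e : R) : 0 < complex.Re xi -> 0 < e ->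
  \forall m \near \oo, forall y : R, `|y| <= b0 ->
  normc (grid_sum m (shifted_gauss xi y) - (sqrtc xi)^-1) < e.
Proof.
move=> xi0 e0; have xi_neq0 := Re_gt0_neq0 xi0.
have := Re_sqrtc_gt xi0; set s := sqrtc xi; rewrite ltr_norml => /andP[sl sr].
have s0 : s != 0 by rewrite sqrtc_eq0.
have ns : 0 < normc s by rewrite normc_gt0.
pose d := complex.Re s - `|complex.Im s|; pose M := normc s + b0 / normc s.
have d0 : 0 < d by rewrite subr_gt0 ltr_norml sl.
have [dB dD] :
    d <= complex.Re s - complex.Im s /\ d <= complex.Re s + complex.Im s.
  by have := ler_norm (complex.Im s); have := ler_norm (- complex.Im s);
    rewrite normrN /d; lra.
apply: filterS (grid_sum_cgauss_near M d0 (mulr_gt0 e0 ns)) => m close y yb0.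
have b00 : 0 <= b0 := le_trans (normr_ge0 y) yb0.
pose t : R[i] := 'i * y%:C / s.
have tM : normc t <= b0 / normc s.
  rewrite /t !normcM normcV normc_real /= expr0n expr1n add0r sqrtr1 mul1r.
  by rewrite ler_wpM2r ?invr_ge0 ?normc_ge0.
set S := grid_sum m _; have -> : S - s^-1 = (s * S - 1) / s by field.
rewrite normcM normcV ltr_pdivrMr//.
have -> : s * S = grid_sum m (fun x => s * cgauss s t x).
  rewrite grid_sumZ; congr (_ * _); apply: eq_bigr => z _.
  by rewrite shifted_gaussE.
apply: close => //; rewrite /M ?(le_trans tM) ?lerDr ?lerDl ?normc_ge0//.
by rewrite divr_ge0 ?normc_ge0.
Qed.

Lemma normc_prod_expB_lt (n : nat) s (e : R) : 0 < e -> exists2 d : R, 0 < d &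
  forall F : 'I_n -> R[i], (forall i, normc (F i - s) < d) ->
    normc (\prod_(i < n) F i - s ^+ n) < e.
Proof.
move=> e0; pose A := normc s + 1; have A1 : 1 <= A by rewrite lerDr normc_ge0.
pose K := n%:R * A ^+ n.
have K0 : 0 <= K by rewrite mulr_ge0// exprn_ge0// (le_trans ler01).
have K1 : 0 < K + 1 by rewrite ltr_wpDl.
exists (Num.min 1 (e / (K + 1))); first by rewrite lt_min ltr01 divr_gt0.
move=> F Fs; set d := Num.min _ _ in Fs.
have d_le : d <= 1 by rewrite ge_min lexx.
have Kd : K * d < e.
  apply: (@lt_le_trans _ _ (d * (K + 1))); last first.
    by rewrite -ler_pdivlMr// ge_min lexx orbT.
  by rewrite mulrDr mulr1 mulrC ltrDl lt_min ltr01 divr_gt0.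
have Fs_le i : `|F i - s| <= d%:C by rewrite normr_normc lecR ltW.
have sA : `|s| <= A%:C by rewrite normr_normc lecR lerDl.
have FA i : `|F i| <= A%:C.
  rewrite normr_normc lecR -[F i](subrK s) addrC (le_trans (le_normcD _ _))//.
  by rewrite lerD2l (le_trans (ltW (Fs i))).
have A1C : 1 <= A%:C by rewrite lecR.
have := ler_norm_prodB A1C FA (fun=> sA) Fs_le.
rewrite prodr_const card_ord normr_normc -(rmorph_nat (real_complex R)).
rewrite -(rmorphXn (real_complex R)) -!(rmorphM (real_complex R)) lecR.
by move=> /le_lt_trans; apply.
Qed.

Lemma finite_Bxi_cvg xi n (b0 e : R) :
  0 < complex.Re xi -> pos_even n -> 0 < e ->
  exists N : int, forall n', pos_even n' -> N < n' -> forall b,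
    (forall k, lat n k -> `|b k| <= b0) ->
  normc (finite_Bxi xi n n' b - (sqrtc xi)^-1 ^ (n ^+ 2)) < e.
Proof.
move=> xi0 /pos_even_int[m m0 ->] e0.
have [d d0 prod_close] := normc_prod_expB_lt (4 * m ^ 2) (sqrtc xi)^-1 e0.
have [M _ sum_close] := grid_sum_shifted_gauss_near b0 xi0 d0.
exists (2 * M)%:Z => _ /pos_even_int[m' m'0 ->] Mm' b bb0.
have -> : (2 * m)%:Z ^+ 2 = (4 * m ^ 2)%:Z by rewrite !PoszM; ring.
rewrite finite_Bxi_prod// -exprnP; apply: prod_close => z.
apply: sum_close; first by rewrite /=; lia.
by apply: bb0; rewrite lattice_grid//; exists (z : nat) => //=; exact: ltn_ord.
Qed.

End FiniteGaussianTransform.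

(** * Transfer to the double ultrapower *)

Lemma filter_choice (I T : Type) (F : set_system I) {F_proper : ProperFilter F}
    (P : I -> T -> Prop) :
  F [set i | exists t, P i t] <-> exists x : I -> T, F [set i | P i (x i)].
Proof.
split=> [exP|[x]]; last by apply: filterS => i Pix; exists (x i).
have [i0 [t0 _]] := filter_ex exP.
have /boolp.choice[x xP] : forall i, exists t, (exists t, P i t) -> P i t.
  move=> i; have [[t Pit]|] := pselect (exists t, P i t); last by exists t0.
  by exists t.
by exists x; apply: filterS exP => i; exact: xP.
Qed.

Section UltrapowerClasses.
Context {I : Type} {F : npUltraFilter I}.

Lemma uclsD (V : zmodType) (f g : I -> V) :
  ucls F f + ucls F g = ucls F (fun i => f i + g i).
Proof. exact: umap2_cls. Qed.

Lemma uclsN (V : zmodType) (f : I -> V) : - ucls F f = ucls F (fun i => - f i).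
Proof. exact: umap_cls. Qed.

Lemma uclsM (A : comNzRingType) (f g : I -> A) :
  ucls F f * ucls F g = ucls F (fun i => f i * g i).
Proof. exact: umap2_cls. Qed.

Lemma uclsX (A : comNzRingType) (f : I -> A) n :
  ucls F f ^+ n = ucls F (fun i => f i ^+ n).
Proof.
elim: n => [//|n IHn]; rewrite exprS IHn uclsM.
by congr (ucls F _); apply/funext => i; rewrite exprS.
Qed.

Lemma ucls_natr (A : comNzRingType) n : n%:R = ucls F (fun=> n%:R : A).
Proof.
elim: n => [//|n IHn]; rewrite -natr1 IHn.
apply: (etrans (uclsD (fun=> n%:R) (fun=> 1))).
by congr (ucls F _); apply/funext => i; rewrite natr1.
Qed.

Lemma uclsV (A : comUnitRingType) (f : I -> A) :
  (ucls F f)^-1 = ucls F (fun i => (f i)^-1).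
Proof. exact: umap_cls. Qed.

Lemma ucls_norm (K : numDomainType) (f : I -> K) :
  `|ucls F f| = ucls F (fun i => `|f i|).
Proof. exact: umap_cls. Qed.

Lemma ucls_le (K : numDomainType) (f g : I -> K) :
  (ucls F f <= ucls F g) <-> F [set i | f i <= g i].
Proof. by split=> [/asboolP/urel_cls//|fg]; apply/asboolP/urel_cls. Qed.

Lemma ucls_lt (K : numDomainType) (f g : I -> K) :
  (ucls F f < ucls F g) <-> F [set i | f i < g i].
Proof. by split=> [/asboolP/urel_cls//|fg]; apply/asboolP/urel_cls. Qed.

Lemma lattice_ucls (Z0 : Type) (K : numDomainType) (iota : Z0 -> K)
    (n : I -> Z0) :
  lattice (umap iota) (ucls F n) = uext (ucls F (fun i => lattice iota (n i))).
Proof.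
apply/seteqP; split; elim/uclsW => x.
  move=> [z]; elim/uclsW: z => z.
  rewrite /lattice/= !umap_cls uclsV uclsM (ucls_natr K 2) uclsV uclsM uclsN.
  move=> [/uclsP xE /andP[/ucls_le lo /ucls_lt up]]; apply/urel_cls.
  by apply: filterS3 xE lo up => i /= xE lo up; exists (z i); rewrite lo.
move=> /urel_cls/filter_choice[z xP]; exists (ucls F z).
rewrite !umap_cls uclsV uclsM (ucls_natr K 2) uclsV uclsM uclsN; split.
  by apply/uclsP; apply: filterS xP => i [].
by apply/andP; split; [apply/ucls_le|apply/ucls_lt];
  apply: filterS xP => i /= [_ /andP[]].
Qed.

Lemma pos_even_ucls (D : numDomainType) (x : I -> D) :
  pos_even (ucls F x) <-> F [set i | pos_even (x i)].
Proof.
split=> [[x0 [k]]|xF].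
  elim/uclsW: k => k; rewrite ucls_natr uclsM => /uclsP xE.
  move/ucls_lt: x0 => x0.
  by apply: filterS2 x0 xE => i x0 xE; split=> //; exists (k i).
split; first by apply/ucls_lt; apply: filterS xF => i [].
have /filter_choice[k xE] : F [set i | exists k, x i = 2 * k].
  by apply: filterS xF => i [].
by exists (ucls F k); rewrite ucls_natr uclsM; apply/uclsP.
Qed.

End UltrapowerClasses.

Section FubiniProduct.
Context {I1 I2 : Type} (F1 : npUltraFilter I1) (F2 : npUltraFilter I2).

Definition npu_prod_sets : set_system (I2 * I1) :=
  [set P | F2 [set i | F1 [set j | P (i, j)]]].

Lemma npu_prod_sets_proper : ProperFilter npu_prod_sets.
Proof.
split; [|split].
- rewrite /npu_prod_sets/= => F0; apply: (@filter_not_empty _ F2 _).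
  by apply: filterS F0 => i; exact: filter_not_empty.
- by rewrite /npu_prod_sets/=; apply: filterS filterT => i _; exact: filterT.
- move=> P Q; rewrite /npu_prod_sets/= => FP FQ.
  by apply: filterS2 FP FQ => i; exact: filterI.
- move=> P Q PQ; rewrite /npu_prod_sets/=.
  by apply: filterS => i; apply: filterS => j; exact: PQ.
Qed.

Lemma npu_prod_sets_ultra : UltraFilter npu_prod_sets.
Proof.
split=> [|G G_proper FG]; first exact: npu_prod_sets_proper.
apply/seteqP; split=> // P GP; rewrite /npu_prod_sets/=.
apply: contrapT => /npu_not FnP.
have /FG GnP : npu_prod_sets (~` P).
  by rewrite /npu_prod_sets/=; apply: filterS FnP => i /npu_not.
by apply: (@filter_not_empty _ G _); apply: filterS2 GP GnP => p.
Qed.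

Lemma npu_prod_sets_nonprincipal p : npu_prod_sets <> [set P | P p].
Proof.
move=> Fp; have : npu_prod_sets [set p] by rewrite Fp.
rewrite /npu_prod_sets/= => Fsingle; apply: (@npu_nonprincipal _ F2 p.1).
have {}Fsingle : F2 [set p.1].
  by apply: filterS Fsingle => i /filter_ex[j /= <-].
apply/seteqP; split=> A /= => [FA|Ap]; last by apply: filterS Fsingle => _ ->.
have /filter_ex[i [Ai <-]] : F2 (A `&` [set p.1]) by exact: filterI.
exact: Ai.
Qed.

Definition npu_prod : npUltraFilter (I2 * I1) :=
  NpUltraFilter npu_prod_sets_ultra npu_prod_sets_nonprincipal.

Lemma npu_prodE P : npu_prod P = F2 [set i | F1 [set j | P (i, j)]].
Proof. by []. Qed.

Lemma npu_prod_fst (P : set I2) : F2 P -> npu_prod [set p | P p.1].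
Proof.
by rewrite npu_prodE; apply: filterS => i Pi; apply: filterS filterT.
Qed.

Lemma npu_prod_forall_finite (T : choiceType) (A : I2 -> set T)
    (P : I2 * I1 -> set T) :
  (forall i, finite_set (A i)) ->
  (forall x : I2 -> T,
    F2 [set i | A i (x i)] -> npu_prod [set p | P p (x p.1)]) ->
  npu_prod [set p | A p.1 `<=` P p].
Proof.
move=> finA AP; rewrite npu_prodE.
have : F2 [set i | A i `<=` [set t | F1 [set j | P (i, j) t]]].
  by apply: npu_forall => x; exact: AP.
apply: filterS => i APi; set a := fset_set (A i).
have in_a t : t \in a = (t \in A i) by rewrite in_fset_set.
have : F1 [set j | forall t : a, P (i, j) (val t)].
  by apply: filter_forall => t; apply: APi; rewrite -in_setE -in_a; exact: valP.
apply: filterS => j Pj t At.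
have ta : t \in a by rewrite in_a in_setE.
exact: (Pj [` ta]%fset).
Qed.

End FubiniProduct.

(* An element of the double ultrapower is the class of a function on I2 * I1  *)
(* modulo equality almost everywhere for the Fubini product of F2 and F1.     *)
Section DoubleClasses.
Context (I1 I2 : Type) (F1 : npUltraFilter I1) (F2 : npUltraFilter I2).
Local Notation FF := (npu_prod F1 F2).

Definition dcls (T : Type) (f : I2 * I1 -> T) : dpow F1 F2 T :=
  ucls F2 (fun i => ucls F1 (fun j => f (i, j))).

Lemma dclsP (T : Type) (f g : I2 * I1 -> T) :
  dcls f = dcls g <-> FF [set p | f p = g p].
Proof. by rewrite uclsP npu_prodE; split; apply: filterS => i /uclsP. Qed.

Lemma dclsW (T : Type) (P : dpow F1 F2 T -> Prop) :
  (forall f, P (dcls f)) -> forall x, P x.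
Proof.
move=> Pf; elim/uclsW => f.
have -> : f = fun i => ucls F1 (fun j => urepr (f i) j).
  by apply/funext => i; exact/esym/ureprK.
exact: (Pf (fun p => urepr (f p.1) p.2)).
Qed.

Lemma starmap_ucls (T : Type) (f : I2 -> T) :
  starmap F1 (ucls F2 f) = dcls (fun p => f p.1).
Proof. exact: umap_cls. Qed.

Lemma dstdE (T : Type) (x : T) : dstd F1 F2 x = dcls (fun=> x).
Proof. exact: starmap_ucls. Qed.

Lemma dmap_dcls (T U : Type) (g : T -> U) (f : I2 * I1 -> T) :
  dmap g (dcls f) = dcls (fun p => g (f p)).
Proof.
rewrite /dmap umap_cls; congr (ucls F2 _); apply/funext => i.
exact: umap_cls.
Qed.

Lemma dmap2_dcls (T U V : Type) (g : T -> U -> V) (f : I2 * I1 -> T) f' :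
  dmap2 g (dcls f) (dcls f') = dcls (fun p => g (f p) (f' p)).
Proof.
rewrite /dmap2 umap2_cls; congr (ucls F2 _); apply/funext => i.
exact: umap2_cls.
Qed.

Lemma dapp_dcls (T U : Type) (g : I2 * I1 -> T -> U) (f : I2 * I1 -> T) :
  dapp (dcls g) (dcls f) = dcls (fun p => g p (f p)).
Proof.
rewrite /dapp umap2_cls; congr (ucls F2 _); apply/funext => i.
exact: umap2_cls.
Qed.

Lemma dclsD (V : zmodType) (f g : I2 * I1 -> V) :
  dcls f + dcls g = dcls (fun p => f p + g p).
Proof. exact: dmap2_dcls. Qed.

Lemma dclsN (V : zmodType) (f : I2 * I1 -> V) :
  - dcls f = dcls (fun p => - f p).
Proof. exact: dmap_dcls. Qed.

Lemma dclsM (A : comNzRingType) (f g : I2 * I1 -> A) :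
  dcls f * dcls g = dcls (fun p => f p * g p).
Proof. exact: dmap2_dcls. Qed.

Lemma dclsX (A : comNzRingType) (f : I2 * I1 -> A) n :
  dcls f ^+ n = dcls (fun p => f p ^+ n).
Proof.
by rewrite uclsX; congr (ucls F2 _); apply/funext => i; exact: uclsX.
Qed.

Lemma dcls_natr (A : comNzRingType) n : n%:R = dcls (fun=> n%:R : A).
Proof.
by rewrite ucls_natr; congr (ucls F2 _); apply/funext => i; exact: ucls_natr.
Qed.

Lemma dclsV (A : comUnitRingType) (f : I2 * I1 -> A) :
  (dcls f)^-1 = dcls (fun p => (f p)^-1).
Proof. exact: dmap_dcls. Qed.

Lemma dcls_norm (K : numDomainType) (f : I2 * I1 -> K) :
  `|dcls f| = dcls (fun p => `|f p|).
Proof. exact: dmap_dcls. Qed.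

Lemma dcls_le (K : numDomainType) (f g : I2 * I1 -> K) :
  (dcls f <= dcls g) <-> FF [set p | f p <= g p].
Proof. by rewrite ucls_le npu_prodE; split; apply: filterS => i /ucls_le. Qed.

Lemma dcls_lt (K : numDomainType) (f g : I2 * I1 -> K) :
  (dcls f < dcls g) <-> FF [set p | f p < g p].
Proof. by rewrite ucls_lt npu_prodE; split; apply: filterS => i /ucls_lt. Qed.

Lemma pos_even_dcls (D : numDomainType) (x : I2 * I1 -> D) :
  pos_even (dcls x) <-> FF [set p | pos_even (x p)].
Proof.
by rewrite pos_even_ucls npu_prodE; split; apply: filterS => i /pos_even_ucls.
Qed.

Lemma dext_dcls (T : Type) (A : I2 * I1 -> set T) (x : I2 * I1 -> T) :
  dext (dcls A) (dcls x) <-> FF [set p | A p (x p)].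
Proof.
rewrite [dext _ _]urel_cls npu_prodE.
by split; apply: filterS => i Axi; [move/urel_cls: Axi|apply/urel_cls].
Qed.

Lemma dext_uext (T : Type) (A : I2 -> upow F1 (set T)) :
  dext (ucls F2 A) = uext (ucls F2 (fun i => uext (A i))).
Proof.
by apply/seteqP; split; elim/uclsW => x /urel_cls xA; apply/urel_cls.
Qed.

Lemma star_set_uext (T : Type) (A : I2 -> set T) :
  star_set F1 (uext (ucls F2 A)) = dext (dcls (fun p => A p.1)).
Proof.
rewrite -starmap_ucls; apply/seteqP; split=> [x [_ [/uext_inj <-]] //|x xA].
by exists (ucls F2 A).
Qed.

Lemma zext_funs_dcls (T : choiceType) (V : zmodType) (A : I2 * I1 -> set T)
    (B : I2 * I1 -> set V) :
  [set f : dpow F1 F2 (T -> V) |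
    (forall k, dext (dcls A) k -> dext (dcls B) (dapp f k)) /\
    (forall k, ~ dext (dcls A) k -> dapp f k = 0)] =
  dext (dcls (fun p => zext_funs (A p) (B p))).
Proof.
apply/seteqP; split; elim/dclsW => f.
- move=> [fB f0]; apply/dext_dcls.
  have AB : FF [set p | A p `<=` [set k | B p (f p k)]].
    apply: npu_forall => x Ax; apply/dext_dcls.
    by rewrite -dapp_dcls; apply: fB; apply/dext_dcls.
  have A0 : FF [set p | ~` A p `<=` [set k | f p k = 0]].
    apply: npu_forall => x /npu_not nAx; apply/dclsP.
    by rewrite -dapp_dcls; apply: f0 => /dext_dcls.
  by apply: filterS2 AB A0 => p.
- move=> /dext_dcls fAB; split; elim/dclsW => x Ax; rewrite dapp_dcls.
  + move/dext_dcls: Ax => Ax; apply/dext_dcls.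
    by apply: filterS2 fAB Ax => p /= [+ _]; apply.
  + have /npu_not nAx : ~ FF [set p | A p (x p)] by move/dext_dcls.
    rewrite -[RHS]/(dcls (fun=> 0)); apply/dclsP.
    by apply: filterS2 fAB nAx => p /= [_ +]; apply.
Qed.

Lemma isum_dcls (T : choiceType) (V : zmodType) (A : I2 * I1 -> set T)
    (f : dpow F1 F2 T -> dpow F1 F2 V) (phi : I2 * I1 -> T -> V) :
  (forall p, finite_set (A p)) ->
  (forall x, f (dcls x) = dcls (fun p => phi p (x p))) ->
  isum (dext (dcls A)) f = dcls (fun p => \sum_(t \in A p) phi p t).
Proof.
move=> finA fphi; rewrite (@isumE _ _ _ _ _ _ _ _ (dcls phi)) ?dmap2_dcls//.
  apply/upred_cls; apply: filterS filterT => i _ /=.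
  by apply/upred_cls; apply: filterS filterT => j _ /=.
by elim/dclsW => x _; rewrite fphi dapp_dcls.
Qed.

End DoubleClasses.

Section StandardPart.
Context {R : realType} {I1 I2 : Type}.
Context {F1 : npUltraFilter I1} {F2 : npUltraFilter I2}.
Local Notation FF := (npu_prod F1 F2).
Local Notation starC := (upow F2 R[i]).
Local Notation dC := (dpow F1 F2 R[i]).

Definition infinitely_close (x : dC) (y : starC) : Prop :=
  forall e : upow F2 R, 0 < e ->
    `|x - starmap F1 y| < starmap F1 (starC_of e).

Lemma infinitely_close_dcls (x : I2 * I1 -> R[i]) (y : I2 -> R[i]) :
  infinitely_close (dcls F1 F2 x) (ucls F2 y) <->
  forall e : I2 -> R, F2 [set i | 0 < e i] ->
    FF [set p | normc (x p - y p.1) < e p.1].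
Proof.
have ballE (e : I2 -> R) :
    `|dcls F1 F2 x - starmap F1 (ucls F2 y)| <
      starmap F1 (starC_of (ucls F2 e)) <->
    FF [set p | normc (x p - y p.1) < e p.1].
  rewrite /starC_of umap_cls !starmap_ucls dclsN dclsD dcls_norm dcls_lt.
  by split; apply: filterS => p /=; rewrite normr_normc ltcR.
split=> [xy e e0|xy]; first by apply/ballE/xy/ucls_lt.
by elim/uclsW => e /ucls_lt e0; apply/ballE/xy.
Qed.

Lemma infinitely_close_st_dom (x : dC) (y : starC) :
  infinitely_close x y -> st_dom x.
Proof.
elim/dclsW: x => x; elim/uclsW: y => y /(_ 1 ltr01).
rewrite [1]/(ucls F2 (fun=> 1)) /starC_of umap_cls !starmap_ucls.
rewrite dclsN dclsD dcls_norm => /dcls_lt xy1.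
exists (ucls F2 (fun i => normc (y i) + 1)).
rewrite /starC_of umap_cls starmap_ucls dcls_norm; apply/dcls_le.
apply: filterS xy1 => p /=.
rewrite !normr_normc ltcR lecR => xy1.
rewrite -[x p](subrK (y p.1)) addrC (le_trans (le_normcD _ _))//.
by rewrite lerD2l ltW.
Qed.

Lemma infinitely_close_unique (x : dC) (y z : starC) :
  infinitely_close x y -> infinitely_close x z -> y = z.
Proof.
elim/dclsW: x => x; elim/uclsW: y => y; elim/uclsW: z => z.
move=> /infinitely_close_dcls xy /infinitely_close_dcls xz.
apply/uclsP; apply: contrapT => /npu_not yz.
pose e i := normc (y i - z i) / 2.
have e0 : F2 [set i | 0 < e i].
  by apply: filterS yz => i /eqP yzi; rewrite /= divr_gt0 ?normc_gt0 ?subr_eq0.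
have /filter_ex[p [/= xyp xzp]] : FF ([set p | normc (x p - y p.1) < e p.1] `&`
    [set p | normc (x p - z p.1) < e p.1]).
  by apply: filterI; [exact: xy|exact: xz].
have := le_normcD (x p - z p.1) (- (x p - y p.1)).
rewrite (normcN (x p - y p.1)).
have -> : x p - z p.1 - (x p - y p.1) = y p.1 - z p.1 by ring.
by move: xyp xzp; rewrite /e; lra.
Qed.

Lemma infinitely_close_st (x : dC) (y : starC) :
  infinitely_close x y -> st x = y.
Proof.
move=> xy; apply: xget_unique => // z xz.
exact: infinitely_close_unique xz xy.
Qed.

Lemma infinitely_close_div (x : dC) (y : starC) :
  y != 0 -> infinitely_close x y -> infinitely_close (x / starmap F1 y) 1.
Proof.
elim/dclsW: x => x; elim/uclsW: y => y y0 /infinitely_close_dcls xy.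
have {}y0 : F2 [set i | y i != 0].
  have /npu_not : ~ F2 [set i | y i = 0].
    by move/uclsP => y0E; rewrite y0E eqxx in y0.
  by apply: filterS => i /eqP.
rewrite starmap_ucls dclsV dclsM.
apply/(infinitely_close_dcls _ (fun=> 1)) => e e0.
have ey0 : F2 [set i | 0 < e i * normc (y i)].
  by apply: filterS2 e0 y0 => i /= ei yi; rewrite mulr_gt0 ?normc_gt0.
apply: filterS2 (xy _ ey0) (npu_prod_fst F1 y0) => p /= xyp yp.
have -> : x p / y p.1 - 1 = (x p - y p.1) / y p.1 by field.
by rewrite normcM normcV ltr_pdivrMr ?normc_gt0.
Qed.

Lemma std_ball (y z : R[i]) (e : R) :
  `|std F2 y - std F2 z| < std F2 e%:C <-> normc (y - z) < e.
Proof.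
rewrite /std uclsN uclsD ucls_norm ucls_lt normr_normc ltcR.
by split=> [/filter_ex[]//|yz]; apply: filterS filterT.
Qed.

Lemma st0_dom_std (y : R[i]) : st0_dom (std F2 y).
Proof.
exists (normc y); rewrite /std ucls_norm; apply/ucls_le.
by apply: filterS filterT => i _ /=.
Qed.

Lemma st0_std (y : R[i]) : st0 (std F2 y) = y.
Proof.
apply: xget_unique => [e e0|z yz].
  by apply/std_ball; rewrite subrr normc0.
apply/eqP; rewrite eq_sym -subr_eq0 -[_ == 0]negbK -normc_gt0; apply/negP.
by move=> /[dup] yz0 /yz /std_ball; rewrite ltxx.
Qed.

Lemma infinitely_close1_bst (x : dC) :
  infinitely_close x 1 -> bst_dom x /\ bst x = 1.
Proof.
move=> x1; rewrite /bst_dom /bst (infinitely_close_st x1).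
split; last exact: st0_std.
by split; [exact: infinitely_close_st_dom x1|exact: st0_dom_std].
Qed.

End StandardPart.

Lemma starC_expz_neq0 {R : realType} {I : Type} (F : npUltraFilter I) (x : R[i])
    (n : upow F int) :
  x != 0 -> starC_expz (std F x) n != 0.
Proof.
move=> x0; elim/uclsW: n => n; rewrite /starC_expz umap2_cls.
rewrite -[X in _ != X]/(ucls F (fun=> 0)).
apply/eqP => /uclsP/filter_ex[i /= /eqP]; apply/negP.
exact: expfz_neq0.
Qed.

Section InternalSets.
Context {R : realType} {I1 I2 : Type}.
Context {F1 : npUltraFilter I1} {F2 : npUltraFilter I2}.
Implicit Types h : I2 -> int.
Local Notation FF := (npu_prod F1 F2).
Local Notation dcls := (@dcls I1 I2 F1 F2 _).
Local Notation lat := (@lattice int R intr).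

Lemma latL_ucls h : latL (ucls F2 h) = uext (ucls F2 (fun i => lat (h i))).
Proof. exact: lattice_ucls. Qed.

Lemma star_latL h :
  star_set F1 (latL (ucls F2 h)) = dext (dcls (fun p => lat (h p.1))).
Proof. by rewrite latL_ucls star_set_uext. Qed.

Lemma latL'_dcls (h' : I2 * I1 -> int) :
  latL' (dcls h') = dext (dcls (fun p => lat (h' p))).
Proof.
rewrite dext_uext -[LHS]/(lattice (umap (umap intr)) _) lattice_ucls.
by congr (uext (ucls F2 _)); apply/funext => i; exact: lattice_ucls.
Qed.

Lemma funX_dcls h (h' : I2 * I1 -> int) :
  funX (ucls F2 h) (dcls h') =
  dext (dcls (fun p => zext_funs (lat (h p.1)) (lat (h' p)))).
Proof. by rewrite /funX star_latL latL'_dcls zext_funs_dcls. Qed.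

Lemma sumL_dcls h (V : zmodType) (f : dpow F1 F2 R -> dpow F1 F2 V)
    (phi : I2 * I1 -> R -> V) :
  (forall x, f (dcls x) = dcls (fun p => phi p (x p))) ->
  sumL (ucls F2 h) f = dcls (fun p => \sum_(k \in lat (h p.1)) phi p k).
Proof.
move=> fphi; rewrite /sumL star_latL; apply: isum_dcls => // p.
exact: finite_lattice.
Qed.

Lemma sumX_dcls h (h' : I2 * I1 -> int) (V : zmodType)
    (f : dpow F1 F2 (R -> R) -> dpow F1 F2 V) (phi : I2 * I1 -> (R -> R) -> V) :
  (forall x, f (dcls x) = dcls (fun p => phi p (x p))) ->
  isum (funX (ucls F2 h) (dcls h')) f =
    dcls (fun p => \sum_(a \in zext_funs (lat (h p.1)) (lat (h' p))) phi p a).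
Proof.
move=> fphi; rewrite funX_dcls; apply: isum_dcls => // p.
by apply: finite_zext_funs; exact: finite_lattice.
Qed.

Lemma bounded_dcls h (b : I2 * I1 -> R -> R) (b0 : I2 -> R) :
  (forall k : upow F2 R, latL (ucls F2 h) k ->
    `|dapp (dcls b) (starmap F1 k)| <= starmap F1 (ucls F2 b0)) ->
  FF [set p | forall k, lat (h p.1) k -> `|b p k| <= b0 p.1].
Proof.
rewrite latL_ucls => bb0.
apply: (@npu_prod_forall_finite _ _ _ _ _ (fun i => lat (h i))
  (fun p => [set k | `|b p k| <= b0 p.1])) => [i|k Lk].
  exact: finite_lattice.
have /bb0 : uext (ucls F2 (fun i => lat (h i))) (ucls F2 k) by apply/urel_cls.
by rewrite !starmap_ucls dapp_dcls dcls_norm => /dcls_le.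
Qed.

End InternalSets.

Section GaussianTransform.
Context {R : realType} {I1 I2 : Type}.
Context {F1 : npUltraFilter I1} {F2 : npUltraFilter I2}.
Local Notation dcls := (@dcls I1 I2 F1 F2 _).
Local Notation dX := (dpow F1 F2 (R -> R)).
Local Notation lat := (@lattice int R intr).
Implicit Types (h : I2 -> int) (H : upow F2 int) (xi : R[i])
  (a b : I2 * I1 -> R -> R).

Lemma dC_of_dcls (x : I2 * I1 -> R) : dC_of (dcls x) = dcls (fun p => (x p)%:C).
Proof. exact: dmap_dcls. Qed.

Lemma gauss_dcls h xi (c : dpow F1 F2 R -> dpow F1 F2 R[i])
    (c' : I2 * I1 -> R -> R[i]) :
  (forall x, c (dcls x) = dcls (fun p => c' p (x p))) ->
  gauss (ucls F2 h) xi c = dcls (fun p => finite_gauss xi (h p.1) (c' p)).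
Proof.
move=> cc'; rewrite /gauss.
rewrite (@sumL_dcls _ _ _ _ _ _ _ _ (fun p k => c' p k ^+ 2)).
  by rewrite !dstdE !dclsM dclsN /dexp dmap_dcls.
by move=> x; rewrite cc' dclsX.
Qed.

Lemma gaussX_dcls h xi a :
  gaussX (ucls F2 h) xi (dcls a) =
  dcls (fun p => finite_gauss xi (h p.1) (fun k => (a p k)%:C)).
Proof.
rewrite /gaussX (@gauss_dcls _ _ _ (fun p k => (a p k)%:C))// => x.
by rewrite dapp_dcls dC_of_dcls.
Qed.

Lemma gauss_scaled_dcls h xi b :
  gauss (ucls F2 h) xi (fun k => dC_of (dapp (dcls b) k) / dstd F1 F2 xi) =
  dcls (fun p => finite_gauss xi (h p.1) (fun k => (b p k)%:C / xi)).
Proof.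
rewrite (@gauss_dcls _ _ _ (fun p k => (b p k)%:C / xi))// => x.
by rewrite dapp_dcls dC_of_dcls dstdE dclsV dclsM.
Qed.

Lemma eps0_dcls h (h' : I2 * I1 -> int) : eps0 R (ucls F2 h) (dcls h') =
  dcls (fun p => (h' p)%:~R ^ (- h p.1 ^+ 2)).
Proof. by rewrite /eps0 /HR' dmap_dcls starmap_ucls dclsX dclsN dmap2_dcls. Qed.

Lemma FT_gaussX_dcls h (h' : I2 * I1 -> int) xi b :
  FT (ucls F2 h) (dcls h') (gaussX (ucls F2 h) xi) (dcls b) =
  dcls (fun p => finite_FT_gauss xi (h p.1) (h' p) (b p)).
Proof.
apply: sumX_dcls => a; rewrite gaussX_dcls eps0_dcls dC_of_dcls.
rewrite (@sumL_dcls _ _ _ _ _ _ _ _ (fun p k => a p k * b p k)); last first.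
  by move=> x; rewrite !dapp_dcls dclsM.
rewrite dC_of_dcls !dstdE (dcls_natr F1 F2 R[i] 2) !dclsM dclsN.
by rewrite /dexp dmap_dcls !dclsM.
Qed.

Lemma Bxi_dcls h (h' : I2 * I1 -> int) xi b :
  Bxi (ucls F2 h) (dcls h') xi (dcls b) =
  dcls (fun p => finite_Bxi xi (h p.1) (h' p) (b p)).
Proof.
apply: sumX_dcls => a; rewrite eps0_dcls dC_of_dcls.
rewrite -[dexp _]/(gauss _ _ _) (@gauss_dcls _ _ _
  (fun p k => (a p k)%:C + 'i * xi^-1 * (b p k)%:C)) ?dclsM// => x.
by rewrite !dapp_dcls !dC_of_dcls !dstdE dclsV !dclsM dclsD.
Qed.

Lemma funA_gaussX H (H' : dpow F1 F2 int) xi : funA H H' (gaussX H xi).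
Proof.
elim/uclsW: H => h; exists (dcls (fun p (g : R -> R) =>
  finite_gauss xi (h p.1) (fun k => (g k)%:C))).
by elim/dclsW => a _; rewrite gaussX_dcls dapp_dcls.
Qed.

Lemma FT_gaussX H (H' : dpow F1 F2 int) xi (b : dX) : xi != 0 ->
  FT H H' (gaussX H xi) b =
  Bxi H H' xi b * gauss H xi (fun k => dC_of (dapp b k) / dstd F1 F2 xi).
Proof.
move=> xi0; elim/uclsW: H => h; elim/dclsW: H' => h'; elim/dclsW: b => b.
rewrite FT_gaussX_dcls Bxi_dcls gauss_scaled_dcls dclsM; congr dcls.
by apply/funext => p; exact: finite_FT_gaussE.
Qed.

Lemma gauss_scaledE H xi (b : dX) : xi != 0 ->
  gauss H xi (fun k => dC_of (dapp b k) / dstd F1 F2 xi) =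
  dexp (- (dstd F1 F2 (pi%:C) / dstd F1 F2 xi *
    sumL H (fun k => dC_of (dapp b k) ^+ 2))).
Proof.
move=> xi0; elim/uclsW: H => h; elim/dclsW: b => b; rewrite gauss_scaled_dcls.
rewrite (@sumL_dcls _ _ _ _ _ _ _ _ (fun p k => (b p k)%:C ^+ 2)); last first.
  by move=> x; rewrite dapp_dcls dC_of_dcls dclsX.
rewrite !dstdE dclsV !dclsM dclsN /dexp dmap_dcls; congr dcls.
apply/funext => p; congr (cexp (- _)).
rewrite !(fsbig_finite _ _ (finite_lattice _)) !mulr_sumr.
by apply: eq_bigr => k _; move: (pi%:C) => q; field.
Qed.

Lemma Bxi_infinitely_close H (H' : dpow F1 F2 int) xi (b : dX)
    (b0 : upow F2 R) :
  0 < complex.Re xi -> pos_even H -> pos_even H' ->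
  (forall n : upow F2 int, starmap F1 n < H') ->
  (forall k : upow F2 R, latL H k ->
    `|dapp b (starmap F1 k)| <= starmap F1 b0) ->
  infinitely_close (Bxi H H' xi b) (starC_expz (std F2 (sqrtc xi)^-1) (H ^+ 2)).
Proof.
elim/uclsW: H => h; elim/dclsW: H' => h'; elim/dclsW: b => b.
elim/uclsW: b0 => b0.
move=> xi0 /pos_even_ucls h_even /pos_even_dcls h'_even H'oo /bounded_dcls bb0.
rewrite Bxi_dcls /starC_expz uclsX umap2_cls.
apply/infinitely_close_dcls => e e0.
pose close i (N : int) := forall n', pos_even n' -> N < n' -> forall f : R -> R,
  (forall k, lat (h i) k -> `|f k| <= b0 i) ->
  normc (finite_Bxi xi (h i) n' f - (sqrtc xi)^-1 ^ (h i ^+ 2)) < e i.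
have /filter_choice[N NP] : F2 [set i | exists N, close i N].
  by apply: filterS2 h_even e0 => i hi ei; exact: finite_Bxi_cvg.
have /dcls_lt h'N : dcls (fun p => N p.1) < dcls h' by rewrite -starmap_ucls.
apply: filterS3 (filterI (npu_prod_fst F1 NP) h'N) h'_even bb0.
by move=> p [NPp h'Np] h'p bp; exact: NPp.
Qed.

End GaussianTransform.

Theorem theorem3p3 (R : realType) (I1 I2 : Type)
    (I1_infinite : infinite_set [set: I1]) (I2_infinite : infinite_set [set: I2])
    (F1 : npUltraFilter I1) (F2 : npUltraFilter I2)
    (H : upow F2 int) (H_gt0 : 0 < H)
    (H_even : exists K : upow F2 int, H = 2 * K)
    (H_infinite : forall n : int, std F2 n < H)
    (H' : dpow F1 F2 int) (H'_gt0 : 0 < H')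
    (H'_even : exists K : dpow F1 F2 int, H' = 2 * K)
    (H'_infinite : forall n : upow F2 int, starmap F1 n < H')
    (xi : R[i]) (xi_gt0 : 0 < complex.Re xi) :
  funA H H' (gaussX H xi) /\
  forall b : dpow F1 F2 (R -> R), funX H H' b ->
    [/\ FT H H' (gaussX H xi) b =
          Bxi H H' xi b *
          gauss H xi (fun k => dC_of (dapp b k) / dstd F1 F2 xi),
        Bxi H H' xi b *
          gauss H xi (fun k => dC_of (dapp b k) / dstd F1 F2 xi) =
          Bxi H H' xi b *
          dexp (- (dstd F1 F2 (pi%:C) / dstd F1 F2 xi *
                   sumL H (fun k => dC_of (dapp b k) ^+ 2))) &
        (exists b0 : upow F2 R, forall k : upow F2 R, latL H k ->
           `|dapp b (starmap F1 k)| <= starmap F1 b0) ->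
        let c : upow F2 R[i] := starC_expz (std F2 (sqrtc xi)^-1) (H ^+ 2) in
        [/\ st_dom (Bxi H H' xi b),
            st (Bxi H H' xi b) = c,
            bst_dom (Bxi H H' xi b / starmap F1 c) &
            bst (Bxi H H' xi b / starmap F1 c) = 1]].
Proof.
have xi0 := Re_gt0_neq0 xi_gt0.
split=> [|b _]; first exact: funA_gaussX.
split; [exact: FT_gaussX|by rewrite gauss_scaledE|move=> [b0 bb0] c].
have B_close : infinitely_close (Bxi H H' xi b) c.
  exact: Bxi_infinitely_close bb0.
have c0 : c != 0 by apply: starC_expz_neq0; rewrite invr_eq0 sqrtc_eq0.
have [domB1 B1] := infinitely_close1_bst (infinitely_close_div c0 B_close).
split=> //; first exact: infinitely_close_st_dom B_close.
exact: infinitely_close_st B_close.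
Qed.
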